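(* Let $\pi:E\to D$ be an ample holomorphic line bundle over a compact complex manifold $D$ of dimension $n-1\ge1$, with Hermitian metric $h$ whose curvature form is a Kähler form $\omega_D$ on $D$. Let $E'$, $S$, $\omega_0=\sqrt{-1}\partial\overline\partial|S|^{-2}_{\pi^*h}$ and $V=z\partial_z+\bar z\partial_{\bar z}$ be as in the context, and let $$\omega=\omega_0-\mathrm{Ric}(\omega_0)+\sqrt{-1}\partial\overline\partial\sum_{k>0}u_{(k)},\qquad\mathcal L_Vu_{(k)}=k\,u_{(k)},$$ be the unique formal expanding soliton on $E'$ of this form, i.e. the unique formal solution of $\mathrm{Ric}(\omega)+\frac12\mathcal L_V\omega=-\omega$. Then $\omega$ is a gradient expanding soliton: there is a (formal series) function $F$ on $E'$ such that $$i_{V^{(1,0)}}\omega=\sqrt{-1}\,\overline\partial F,\qquad V^{(1,0)}=z\partial_z .$$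
   Context: The curvature form of $h$ is $-\sqrt{-1}\partial\overline\partial\log|s|_h^2$ for a local nonvanishing holomorphic section $s$. $E'$ is the complement of the zero section of $E$. $S$ is the canonical section of $\pi^*E$ over $E$, $S(e)=e$; in a local holomorphic trivialization with coordinates $w$ on $D$ and fiber coordinate $z$, $|S|^2_{\pi^*h}=h(w)z\bar z$. $V$ is globally defined on $E'$, and $V=V^{(1,0)}+V^{(0,1)}$ is its type decomposition. $\mathrm{Ric}(\omega)=-\sqrt{-1}\partial\overline\partial\log\det(g_{i\bar j})$. The index $k$ runs over positive integers and the $u_{(k)}$ are smooth functions on $E'$. Formal identities are identities of formal series graded by $\mathcal L_V$-weight, holding weight by weight; $\mathrm{Ric}(\omega)$ is expanded via $\mathrm{Ric}(\omega)=\mathrm{Ric}(\omega_0)-\sqrt{-1}\partial\overline\partial\,\mathrm{Tr}\log\big(I-\omega_0^{-1}\mathrm{Ric}(\omega_0)+\sqrt{-1}\,\omega_0^{-1}\partial\overline\partial\sum_ku_{(k)}\big)$. Existence and uniqueness of $\{u_{(k)}\}$ is a separate proposition; the $u_{(k)}$ are determined inductively by the weight components of $\mathrm{Tr}\log\big(I-\omega_0^{-1}\mathrm{Ric}(\omega_0)+\sqrt{-1}\,\omega_0^{-1}\partial\overline\partial\sum_ku_{(k)}\big)=\sum_{k>0}(\frac k2+1)u_{(k)}$. *)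

(* Defs.v *)
From HB Require Import structures.
From mathcomp Require Import all_boot all_order all_algebra.
From mathcomp Require Import complex.
From mathcomp Require Import all_classical all_reals all_analysis.

Set Implicit Arguments.
Unset Strict Implicit.
Unset Printing Implicit Defensive.

Import Order.TTheory GRing.Theory Num.Theory.
Import numFieldNormedType.Exports.

Local Open Scope classical_set_scope.
Local Open Scope ring_scope.
Local Open Scope complex_scope.

(* C^m as a real normed space: (x, y) stands for x + sqrt(-1) y. *)
Definition Cn (R : realType) (m : nat) : normedModType R :=
  ('rV[R]_m * 'rV[R]_m)%type.

Section Calculus.
Variable R : realType.

Definition zcoord m (p : Cn R m) (j : 'I_m) : R[i] := p.1 0 j +i* p.2 0 j.

(* C-infinity on an open set U: every iterated directional derivative is
   Frechet differentiable at every point of U. *)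
Definition smooth_on (V : normedModType R) (U : set V) (f : V -> R) : Prop :=
  forall (s : seq V) (p : V), U p ->
    differentiable (foldr (fun v (g : V -> R) => 'D_v g) f s) p.

Definition csmooth_on m (U : set (Cn R m)) (f : Cn R m -> R[i]) : Prop :=
  smooth_on U (fun p => complex.Re (f p)) /\
  smooth_on U (fun p => complex.Im (f p)).

Definition cderive m (v : Cn R m) (f : Cn R m -> R[i]) (p : Cn R m) : R[i] :=
  'D_v (fun q => complex.Re (f q)) p +i* 'D_v (fun q => complex.Im (f q)) p.

Definition ex m (j : 'I_m) : Cn R m := (delta_mx 0 j, 0).
Definition ey m (j : 'I_m) : Cn R m := (0, delta_mx 0 j).

Definition dz m (j : 'I_m) (f : Cn R m -> R[i]) (p : Cn R m) : R[i] :=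
  (cderive (ex j) f p - 'i * cderive (ey j) f p) / 2%:R.
Definition dzb m (j : 'I_m) (f : Cn R m -> R[i]) (p : Cn R m) : R[i] :=
  (cderive (ex j) f p + 'i * cderive (ey j) f p) / 2%:R.

Definition holomorphic_on m (U : set (Cn R m)) (f : Cn R m -> R[i]) : Prop :=
  forall p, U p ->
    [/\ differentiable (fun q => complex.Re (f q)) p,
        differentiable (fun q => complex.Im (f q)) p &
        forall j, dzb j f p = 0].

(* A (1,1)-form sqrt(-1) \sum_(i,j) g_(i,j) dz^i /\ dzbar^j is represented by
   its coefficient matrix g; e.g. sqrt(-1) d dbar f is represented by ddb f. *)
Definition form11 m := Cn R m -> 'M[R[i]]_m.

Definition ddb m (f : Cn R m -> R[i]) : form11 m :=
  fun p => \matrix_(i, j) dz i (dzb j f) p.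

(* The two differential equations below say that the form is closed. *)
Definition kahler_on m (U : set (Cn R m)) (g : form11 m) : Prop :=
  [/\ forall i j, csmooth_on U (fun p => g p i j),
      forall p, U p -> forall v : 'rV[R[i]]_m, v != 0 ->
        0 < (v *m g p *m (map_mx conjc v)^T) 0 0,
      forall p, U p -> forall i j k,
        dz k (fun q => g q i j) p = dz i (fun q => g q k j) p &
      forall p, U p -> forall i j k,
        dzb k (fun q => g q i j) p = dzb j (fun q => g q i k) p].

(* Ric(omega) = - sqrt(-1) d dbar log det g; det g is a positive real number
   when g is positive definite, so ln is applied to its real part. *)
Definition ricci m (g : form11 m) : form11 m :=
  fun p => - ddb (fun q => (ln (complex.Re (\det (g q))))%:C) p.

(* Lie derivatives along the real field X + conj X, where X = \sum_k X^k d/dz^k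
   is holomorphic, on functions and on (1,1)-forms. *)
Definition lie_fun m (X : 'I_m -> Cn R m -> R[i]) (f : Cn R m -> R[i])
    (p : Cn R m) : R[i] :=
  \sum_k (X k p * dz k f p + conjc (X k p) * dzb k f p).

Definition lie_form m (X : 'I_m -> Cn R m -> R[i]) (g : form11 m) : form11 m :=
  fun p => \matrix_(i, j)
    (lie_fun X (fun q => g q i j) p
     + \sum_k (g p k j * dz i (X k) p
               + g p i k * dzb j (fun q => conjc (X k q)) p)).

(* Coefficient of dzbar^j in the contraction of the form g with X. *)
Definition iprod m (X : 'I_m -> Cn R m -> R[i]) (g : form11 m)
    (p : Cn R m) (j : 'I_m) : R[i] :=
  'i * \sum_k X k p * g p k j.

End Calculus.

Section FormalTrLog.
Variables (K : fieldType) (n : nat).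

(* A : nat -> 'M_n is the formal series \sum_k A k, with A k of weight k;
   series_pow A m k is the weight k component of its m-th power. *)
Fixpoint series_pow (A : nat -> 'M[K]_n) (m k : nat) : 'M[K]_n :=
  match m with
  | 0 => if k == 0%N then 1%:M else 0
  | m'.+1 => \sum_(i < k.+1) series_pow A m' (k - i) *m A i
  end.

(* Weight k component of Tr log (I + A) = \sum_m (-1)^(m+1) / m Tr (A^m); for
   A 0 = 0, the only case used, A^m has no component of weight < m. *)
Definition trlog (A : nat -> 'M[K]_n) (k : nat) : K :=
  \sum_(1 <= m < k.+1) (-1) ^+ m.+1 / m%:R * \tr (series_pow A m k).

End FormalTrLog.

Section Geometry.
Variable R : realType.

Record chart (T : topologicalType) (m : nat) := Chart {
  cdom : set T;
  cimg : set (Cn R m);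
  ccoord : T -> Cn R m;
  cpoint : Cn R m -> T;
  open_cdom : open cdom;
  open_cimg : open cimg;
  ccoord_img : forall t, cdom t -> cimg (ccoord t);
  cpoint_dom : forall p, cimg p -> cdom (cpoint p);
  ccoordK : forall t, cdom t -> cpoint (ccoord t) = t;
  cpointK : forall p, cimg p -> ccoord (cpoint p) = p;
  ccoord_continuous : forall t, cdom t -> {for t, continuous ccoord};
  cpoint_continuous : forall p, cimg p -> {for p, continuous cpoint} }.

Definition overlap T m (c c' : chart T m) : set (Cn R m) :=
  [set p | cimg c p /\ cdom c' (cpoint c p)].

Definition holo_transition T m (c c' : chart T m) : Prop :=
  forall j, holomorphic_on (overlap c c')
    (fun p => zcoord (ccoord c' (cpoint c p)) j).

(* Second countability follows from compactness. *)
Record compactComplexManifold (m : nat) := CompactComplexManifold {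
  carrier :> topologicalType;
  atlas_index : Type;
  atlas : atlas_index -> chart carrier m;
  atlas_cover : forall t, exists a, cdom (atlas a) t;
  atlas_holo : forall a b, holo_transition (atlas a) (atlas b);
  carrier_hausdorff : hausdorff_space carrier;
  carrier_compact : compact [set: carrier] }.

(* On C^(1+d) the first coordinate is the fibre coordinate z, the last d
   coordinates are the base coordinates w. *)
Definition fiber d (p : Cn R (1 + d)) : R[i] := zcoord p (lshift d 0).
Definition base d (p : Cn R (1 + d)) : Cn R d := (rsubmx p.1, rsubmx p.2).
Definition with_fiber1 d (w : Cn R d) : Cn R (1 + d) :=
  (row_mx 1%:M w.1, row_mx 0 w.2).

(* A holomorphic line bundle, given by local trivializations over coordinate
   domains of the base: triv a identifies pi^-1 (cdom (tchart a)) with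
   cimg (tchart a) x C, and changes of trivialization act on the fibres as
   multiplication by a nowhere zero holomorphic function. *)
Record lineBundle d (D : compactComplexManifold d) := LineBundle {
  total_space :> topologicalType;
  proj : total_space -> D;
  triv_index : Type;
  tchart : triv_index -> chart D d;
  triv : triv_index -> chart total_space (1 + d);
  proj_continuous : continuous proj;
  tchart_cover : forall t, exists a, cdom (tchart a) t;
  tchart_holo : forall a b,
    holo_transition (tchart a) (atlas b) /\ holo_transition (atlas b) (tchart a);
  triv_dom : forall a e, cdom (triv a) e <-> cdom (tchart a) (proj e);
  triv_img : forall a p, cimg (triv a) p <-> cimg (tchart a) (base p);
  triv_base : forall a e, cdom (triv a) e ->
    base (ccoord (triv a) e) = ccoord (tchart a) (proj e);
  triv_transition : forall a b, exists g : D -> R[i],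
    [/\ holomorphic_on (overlap (tchart b) (tchart a))
          (fun w => g (cpoint (tchart b) w)),
        forall t, cdom (tchart a) t -> cdom (tchart b) t -> g t != 0 &
        forall e, cdom (triv a) e -> cdom (triv b) e ->
          fiber (ccoord (triv a) e) = g (proj e) * fiber (ccoord (triv b) e)] }.

Section OnBundle.
Variables (d : nat) (D : compactComplexManifold d) (E : lineBundle D).
Implicit Types (a b : triv_index E) (N f : E -> R).

(* Holomorphic sections of the m-th tensor power of E, by their components s a
   in the trivializations. *)
Definition holo_section (m : nat) (s : triv_index E -> D -> R[i]) : Prop :=
  (forall a, holomorphic_on (cimg (tchart a)) (fun w => s a (cpoint (tchart a) w)))
  /\ (forall a b (e : E), cdom (triv a) e -> cdom (triv b) e ->
        s a (proj e) * fiber (ccoord (triv b) e) ^+ m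
        = s b (proj e) * fiber (ccoord (triv a) e) ^+ m).

(* Some holomorphic sections of the m-th power define an injective immersion of
   D into a projective space: the last condition says that the section vector
   and its first derivatives are linearly independent (in particular the
   sections have no common zero). *)
Definition power_very_ample (m : nat) : Prop :=
  exists (M : nat) (s : 'I_M -> triv_index E -> D -> R[i]),
    [/\ forall i, holo_section m (s i),
        forall a b t t', cdom (tchart a) t -> cdom (tchart b) t' -> t <> t' ->
          exists i j, s i a t * s j b t' != s j a t * s i b t' &
        forall a w, cimg (tchart a) w ->
          row_free (col_mx
            (\row_i s i a (cpoint (tchart a) w))
            (\matrix_(k < d, i < M)
               dz k (fun v => s i a (cpoint (tchart a) v)) w))].

Definition ample : Prop := exists m : nat, (0 < m)%N /\ power_very_ample m.

(* A Hermitian metric h on E is represented by its square norm N e = |e|_h^2;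
   local_weight N a is |s|_h^2 for the local frame s with fibre coordinate 1. *)
Definition local_weight N a (w : Cn R d) : R := N (cpoint (triv a) (with_fiber1 w)).

Definition hermitian_metric N : Prop :=
  forall a,
    [/\ smooth_on (cimg (tchart a)) (local_weight N a),
        forall w, cimg (tchart a) w -> 0 < local_weight N a w &
        forall p, cimg (triv a) p ->
          (N (cpoint (triv a) p))%:C
          = (local_weight N a (base p))%:C * (fiber p * conjc (fiber p))].

Definition curvature N a : form11 R d :=
  fun w => - ddb (fun v => (ln (local_weight N a v))%:C) w.

(* E', the complement of the zero section, in the trivialization a. *)
Definition img' a : set (Cn R (1 + d)) :=
  [set p | cimg (triv a) p /\ fiber p != 0].

(* Functions on E' are represented by functions on E; their values on the zero
   section are irrelevant. *)
Definition local_fun f a (p : Cn R (1 + d)) : R[i] := (f (cpoint (triv a) p))%:C.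

Definition smooth' f : Prop := forall a, csmooth_on (img' a) (local_fun f a).

(* The components of V^(1,0) = z d/dz. *)
Definition Vhol (i : 'I_(1 + d)) (p : Cn R (1 + d)) : R[i] :=
  if i == lshift d 0 then fiber p else 0.

Definition weight (k : int) f : Prop :=
  forall a p, img' a p ->
    lie_fun Vhol (local_fun f a) p = k%:~R * local_fun f a p.

(* |S|^2 at the point e of E is N e. *)
Definition omega0 N a : form11 R (1 + d) := ddb (local_fun (fun e => (N e)^-1) a).

(* Weight components of omega = omega0 - Ric(omega0) + sqrt(-1) d dbar \sum_k u k *)
Definition omega N (u : nat -> E -> R) (k : int) a : form11 R (1 + d) :=
  fun p =>
    if k == - 2%:Z then omega0 N a p
    else if k == 0 then - ricci (omega0 N a) p
    else if 0 < k then ddb (local_fun (u `|k|%N) a) p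
    else 0.

(* Weight components of
   - omega0^-1 Ric(omega0) + sqrt(-1) omega0^-1 d dbar \sum_k u k;
   omega0 has weight -2, so its inverse raises weights by 2. *)
Definition perturbation N (u : nat -> E -> R) a (p : Cn R (1 + d)) (k : nat) :
    'M[R[i]]_(1 + d) :=
  if k == 2%N then - (invmx (omega0 N a p) *m ricci (omega0 N a) p)
  else if (2 < k)%N then invmx (omega0 N a p) *m ddb (local_fun (u (k - 2)%N) a) p
  else 0.

(* Weight components of
   Ric(omega) = Ric(omega0) - sqrt(-1) d dbar Tr log (I + perturbation). *)
Definition ricci_omega N (u : nat -> E -> R) (k : int) a : form11 R (1 + d) :=
  fun p =>
    if k == 0 then ricci (omega0 N a) p
    else if 0 < k then - ddb (fun q => trlog (perturbation N u a q) `|k|%N) p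
    else 0.

(* The formal equation Ric(omega) + 1/2 L_V omega = - omega on E', together with
   the form of omega; only the u k with k > 0 matter. *)
Definition formal_expanding_soliton N (u : nat -> E -> R) : Prop :=
  (forall k : nat, (0 < k)%N -> smooth' (u k) /\ weight k%:Z (u k)) /\
  (forall (k : int) a p, img' a p ->
     ricci_omega N u k a p + 2%:R^-1 *: lie_form Vhol (omega N u k a) p
     = - omega N u k a p).

(* F stands for the formal series \sum_k F k. *)
Definition formal_function (F : int -> E -> R) : Prop :=
  (forall k, smooth' (F k) /\ weight k (F k)) /\
  (exists k0 : int, forall k, k < k0 ->
     forall a p, img' a p -> local_fun (F k) a p = 0).

(* i_(V^(1,0)) omega = sqrt(-1) dbar F, weight by weight. *)
Definition gradient_potential N (u : nat -> E -> R) (F : int -> E -> R) : Prop :=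
  forall (k : int) a p, img' a p -> forall j : 'I_(1 + d),
    iprod Vhol (omega N u k a) p j = 'i * dzb j (local_fun (F k) a) p.

End OnBundle.
End Geometry.

(* Main.v *)
(* On E' every object splits into |z|^k times data on D, up to the coframe
   (dz/z, dw). If f = |z|^k a(w), then i_(z d/dz) (sqrt(-1) d dbar f) =
   sqrt(-1) dbar (k/2 f); this gives the potential -1/|S|^2 in weight -2 and
   (k/2) u_k in weight k > 0, provided u_k is invariant under the circle action.
   In weight 0, log det omega_0 is a function on D minus (n+1) log |z|^2, so the
   contraction of Ric(omega_0) vanishes.
     Circle invariance is proved by induction on k. The weight k part T of Tr log
   only involves u_j with j < k, hence is |z|^k times a function on D, and the
   soliton equation says that d dbar T = (k/2 + 1) d dbar u_k. The difference
   psi of u_k and its rotation is therefore pluriharmonic, homogeneous of degree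
   k and globally defined on E'. By compactness of D the function
   psi^2 / |S|^(2k) attains its maximum; in a horizontal direction at a maximum
   where psi is not zero, the second derivative test contradicts the positivity
   of the curvature. Hence psi = 0. *)

From mathcomp Require Import all_boot all_order all_algebra.
From mathcomp Require Import complex ring lra.
From mathcomp Require Import all_classical all_reals all_analysis.
Require Import Defs.

Set Implicit Arguments.
Unset Strict Implicit.
Unset Printing Implicit Defensive.

Import Order.TTheory GRing.Theory Num.Theory.
Import numFieldNormedType.Exports.

Local Open Scope classical_set_scope.
Local Open Scope ring_scope.
Local Open Scope complex_scope.

(** The delicate point is regularity. The trace of the logarithm is built from inverse matrices and
    products, and its coefficient on D must be smooth before mixed fibre-base derivatives can be
    computed. Instead of carrying smoothness through that algebra, the proof uses that one
    derivative in z and one in zbar turn |z|^k a(w) into (k/2)^2 |z|^(k-2) a(w), whatever the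
    function a is; the soliton equation then exhibits a as a second derivative of u_k. This is why
    Wirtinger derivatives are handled one coordinate at a time, asking for derivability in the two
    real directions of that coordinate only. A single real second derivative of psi has no sign;
    only the sum of those along v and sqrt(-1) v is governed by d dbar psi, so the maximum is tested
    along both. Positive dimension of D supplies the horizontal direction: over a point, Re z^k is
    pluriharmonic of weight k but not circle invariant. Convention: [rho k z] is |z|^(2k), so weight
    k corresponds to [rho (k / 2)]. *)

(** * Closure properties of smooth real functions on open sets *)

Section SmoothFunctions.
Context {R : realType} {V : normedModType R}.
Implicit Types (U : set V) (f g : V -> R) (p v : V).

Lemma differentiable_near_eq f g p :
  {near p, f =1 g} -> differentiable f p -> differentiable g p.
Proof.
move=> fg df; have fgp := nbhs_singleton fg.
have [cdf Ef] := (diff_locallyP p f).1 df.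
have Eg : g \o shift p = cst (g p) + 'd f p +o_ 0 id.
  apply/eqaddoP => _/posnumP[e].
  move/eqaddoP : Ef => /(_ e%:num [elaborate gt0 e]) Ef.
  have fg0 : \forall h \near (0 : V), f (h + p) = g (h + p).
    have : \forall q \near p, f q = g q by exact: fg.
    by rewrite (near_shift 0) /= subr0.
  near=> h; rewrite !fctE /= -fgp.
  have <- : f (h + p) = g (h + p) by near: h.
  by near: h.
have dg := diff_unique cdf Eg.
by apply/diff_locallyP; rewrite dg.
Unshelve. all: by end_near. Qed.

Lemma open_eq_near U f g p :
  open U -> U p -> (forall q, U q -> f q = g q) -> {near p, f =1 g}.
Proof. by move=> oU Up fg; near=> q; apply: fg; near: q; exact: open_nbhs_nbhs.
Unshelve. all: by end_near. Qed.

(** Both derivatives live on the line [s *: v + p], so the one-variable chain rule applies; this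
    keeps composition available for functions derivable in a single direction. *)
Lemma is_derive_comp1 f (F : R -> R) p v (df dF : R) :
  is_derive p v f df -> is_derive (f p) 1 F dF ->
  is_derive p v (F \o f) (dF * df).
Proof.
move=> [fd <-] [Fd <-].
have lineE (h : V -> R) : (fun t : R => t^-1 *: ((h \o shift p) (t *: v) - h p)) =
    (fun t : R => t^-1 *: (((fun s : R => h (s *: v + p)) \o shift 0) (t *: 1) -
      (fun s : R => h (s *: v + p)) 0)).
  by apply/funext => t /=; rewrite addr0 scale0r add0r [_%:A]mulr1.
have fd1 := (derivable1P _ _ _).1 fd.
have Fd1 : derivable F ((fun s : R => f (s *: v + p)) 0) 1.
  by rewrite /= scale0r add0r.
apply: DeriveDef.
  apply/derivable1P/derivable1_diffP.
  apply: (@differentiable_comp _ _ _ _ (fun s : R => f (s *: v + p)) F).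
    exact/derivable1_diffP.
  exact/derivable1_diffP.
have := derive1_comp fd1 Fd1.
rewrite !derive1E [X in _ = X * _](_ : _ = 'D_1 F (f p)); last first.
  by rewrite scale0r add0r.
by rewrite /derive -!lineE => <-; congr lim; rewrite lineE.
Qed.

(** The hypothesis makes [L] affine with linear part [l], so the two difference quotients coincide.
    It serves for [base], [mkpt z], [rotate c] and parametrized lines. *)
Lemma derive_affine (W : normedModType R) (L l : W -> V) f (q v : W) :
  (forall (t : R) (v q : W), L (t *: v + q) = t *: l v + L q) ->
  'D_v (f \o L) q = 'D_(l v) f (L q).
Proof. by move=> HL; rewrite /derive; congr lim; under eq_fun do rewrite /= HL. Qed.

Lemma derivable_affine (W : normedModType R) (L l : W -> V) f (q v : W) :
  (forall (t : R) (v q : W), L (t *: v + q) = t *: l v + L q) ->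
  derivable (f \o L) q v = derivable f (L q) (l v).
Proof. by move=> HL; rewrite /derivable; under eq_fun do rewrite /= HL. Qed.

(** Smoothness truncated at order [n], peeling off the innermost derivative. It allows induction on
    the order, where the product rule yields sums of products of lower order; a list of directions
    does not lend itself to this. *)
Fixpoint diff_order (n : nat) U f : Prop :=
  (forall p, U p -> differentiable f p) /\
  (if n is m.+1 then forall v, diff_order m U ('D_v f) else True).

Lemma smooth_on_derive U f v : smooth_on U f -> smooth_on U ('D_v f).
Proof. by move=> sf s p Up; have := sf (rcons s v) p Up; rewrite foldr_rcons. Qed.

Lemma smooth_on_differentiable U f p : smooth_on U f -> U p -> differentiable f p.
Proof. exact: (fun sf => sf [::] p). Qed.

Lemma smooth_onP U f : smooth_on U f <-> forall n, diff_order n U f.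
Proof.
split=> [sf n|sf s p Up].
  elim: n f sf => [|n IH] f sf; split=> //; try by move=> p; exact: (sf [::]).
  by move=> v; exact/IH/smooth_on_derive.
elim/last_ind: s f sf => [|s v IH] f sf; first by have [df _] := sf 0%N; exact: df.
by rewrite foldr_rcons; apply: IH => n; have [_] := sf n.+1; apply.
Qed.

Lemma diff_orderW n U f : diff_order n.+1 U f -> diff_order n U f.
Proof.
elim: n f => [|n IH] f [df Df]; split=> // v; exact: IH.
Qed.

Lemma eq_diff_order n U f g : open U -> (forall p, U p -> f p = g p) ->
  diff_order n U f -> diff_order n U g.
Proof.
move=> oU; elim: n f g => [|n IH] f g fg [df Df]; split=> //.
- by move=> p Up; apply: differentiable_near_eq (df p Up); exact: open_eq_near fg.
- by move=> p Up; apply: differentiable_near_eq (df p Up); exact: open_eq_near fg.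
- move=> v; apply: IH (Df v) => p Up; apply: near_eq_derive.
  exact: open_eq_near fg.
Qed.

Lemma diff_order_cst n U (c : R) : diff_order n U (cst c).
Proof.
elim: n c => [|n IH] c; split=> // v.
by rewrite (_ : 'D_v (cst c) = cst 0) //; apply/funext => p; exact: derive_cst.
Qed.

Lemma diff_orderD n U f g : open U ->
  diff_order n U f -> diff_order n U g -> diff_order n U (f + g).
Proof.
move=> oU; elim: n f g => [|n IH] f g [df Df] [dg Dg]; split=> //.
- by move=> p Up; apply: differentiableD; [exact: df|exact: dg].
- by move=> p Up; apply: differentiableD; [exact: df|exact: dg].
- move=> v; apply: eq_diff_order (IH _ _ (Df v) (Dg v)) => // p Up.
  by rewrite deriveD //; apply: diff_derivable; [exact: df|exact: dg].
Qed.

Lemma diff_orderM n U f g : open U ->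
  diff_order n U f -> diff_order n U g -> diff_order n U (f * g).
Proof.
move=> oU; elim: n f g => [|n IH] f g Hf Hg; have [df Df] := Hf; have [dg Dg] := Hg;
  split=> //.
- by move=> p Up; apply: differentiableM; [exact: df|exact: dg].
- by move=> p Up; apply: differentiableM; [exact: df|exact: dg].
- move=> v; apply: (@eq_diff_order _ _ (f * 'D_v g + g * 'D_v f)) => //.
    by move=> p Up; rewrite deriveM //; apply: diff_derivable; [exact: df|exact: dg].
  apply: diff_orderD => //; apply: IH.
  - exact: diff_orderW.
  - exact: Dg.
  - exact: diff_orderW.
  - exact: Df.
Qed.

Lemma diff_orderV n U f : open U -> (forall p, U p -> f p != 0) ->
  diff_order n U f -> diff_order n U (fun p => (f p)^-1).
Proof.
move=> oU f0; elim: n => [|n IH] Hf; have [df Df] := Hf; split=> //.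
- by move=> p Up; apply: differentiableV; [exact: df|exact: f0].
- by move=> p Up; apply: differentiableV; [exact: df|exact: f0].
- move=> v; have Hi := IH (diff_orderW Hf).
  apply: (@eq_diff_order _ _
    (cst (-1) * ((fun p => (f p)^-1) * (fun p => (f p)^-1) * 'D_v f))) => //.
    move=> p Up; rewrite deriveV ?f0 //; last exact/diff_derivable/df.
    by rewrite !fctE /= expr2 invfM mulN1r scaleNr.
  apply: diff_orderM => //; first exact: diff_order_cst.
  by apply: diff_orderM => //; [exact: diff_orderM|exact: Df].
Qed.

Lemma diff_order_ln n U f : open U -> (forall p, U p -> 0 < f p) ->
  diff_order n U f -> diff_order n U (fun p => ln (f p)).
Proof.
move=> oU f0.
have dln p : U p -> differentiable f p -> differentiable (fun p => ln (f p)) p.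
  move=> Up df; apply: differentiable_comp df _; apply/derivable1_diffP.
  by have [] := is_derive1_ln (f0 p Up).
case: n => [|n] Hf; have [df Df] := Hf; split=> //.
- by move=> p Up; apply: dln; [|exact: df].
- by move=> p Up; apply: dln; [|exact: df].
- move=> v; apply: (@eq_diff_order _ _ ((fun p => (f p)^-1) * 'D_v f)) => //.
    move=> p Up; have dfv := derivableP (diff_derivable (v := v) (df p Up)).
    by have [_ ->] := is_derive_comp1 dfv (is_derive1_ln (f0 p Up)).
  apply: diff_orderM => //; last exact: Df.
  apply: diff_orderV => //; last exact: diff_orderW.
  by move=> p Up; rewrite gt_eqF ?f0.
Qed.

Section SmoothClosure.
Variables (U : set V) (oU : open U).

Lemma eq_smooth_on f g : (forall p, U p -> f p = g p) ->
  smooth_on U f -> smooth_on U g.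
Proof. by move=> fg /smooth_onP sf; apply/smooth_onP => n; exact: eq_diff_order (sf n). Qed.

Lemma smooth_on_cst (c : R) : smooth_on U (fun=> c).
Proof. by apply/smooth_onP => n; exact: diff_order_cst. Qed.

Lemma smooth_onD f g :
  smooth_on U f -> smooth_on U g -> smooth_on U (fun p => f p + g p).
Proof.
by move=> /smooth_onP sf /smooth_onP sg; apply/smooth_onP => n; exact: diff_orderD.
Qed.

Lemma smooth_onM f g :
  smooth_on U f -> smooth_on U g -> smooth_on U (fun p => f p * g p).
Proof.
by move=> /smooth_onP sf /smooth_onP sg; apply/smooth_onP => n; exact: diff_orderM.
Qed.

Lemma smooth_onV f : (forall p, U p -> f p != 0) ->
  smooth_on U f -> smooth_on U (fun p => (f p)^-1).
Proof. by move=> f0 /smooth_onP sf; apply/smooth_onP => n; exact: diff_orderV. Qed.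

Lemma smooth_on_ln f : (forall p, U p -> 0 < f p) ->
  smooth_on U f -> smooth_on U (fun p => ln (f p)).
Proof. by move=> f0 /smooth_onP sf; apply/smooth_onP => n; exact: diff_order_ln. Qed.

Lemma smooth_onZ (c : R) f : smooth_on U f -> smooth_on U (fun p => c * f p).
Proof. by move=> sf; apply: smooth_onM => //; exact: smooth_on_cst. Qed.

Lemma smooth_onN f : smooth_on U f -> smooth_on U (fun p => - f p).
Proof.
by move=> /(smooth_onZ (-1)); apply: eq_smooth_on => p _; rewrite mulN1r.
Qed.

End SmoothClosure.

Lemma smooth_on_sub U U' f : U' `<=` U -> smooth_on U f -> smooth_on U' f.
Proof. by move=> sU sf s p /sU; exact: sf. Qed.

Lemma smooth_on_affine (W : normedModType R) (L l : W -> V) U f :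
  (forall (t : R) (v q : W), L (t *: v + q) = t *: l v + L q) ->
  (forall q, differentiable L q) ->
  smooth_on U f -> smooth_on (L @^-1` U) (f \o L).
Proof.
move=> HL dL sf s q Uq.
elim/last_ind: s f sf => [|s v IH] f sf.
  by apply: differentiable_comp => //; exact: smooth_on_differentiable Uq.
rewrite foldr_rcons (_ : 'D_v (f \o L) = ('D_(l v) f) \o L); last first.
  by apply/funext => q'; exact: derive_affine.
by apply: IH; exact: smooth_on_derive.
Qed.

End SmoothFunctions.

(** * Real and imaginary parts, and the squared modulus *)

Section ComplexArithmetic.
Context {R : rcfType}.
Implicit Types x y z : R[i].

Lemma cReD x y : complex.Re (x + y) = complex.Re x + complex.Re y.
Proof. by case: x; case: y. Qed.

Lemma cImD x y : complex.Im (x + y) = complex.Im x + complex.Im y.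
Proof. by case: x; case: y. Qed.

Lemma cReN x : complex.Re (- x) = - complex.Re x. Proof. by case: x. Qed.

Lemma cReM x y :
  complex.Re (x * y) = complex.Re x * complex.Re y - complex.Im x * complex.Im y.
Proof. by case: x; case: y. Qed.

Lemma cImM x y :
  complex.Im (x * y) = complex.Re x * complex.Im y + complex.Im x * complex.Re y.
Proof. by case: x => a b; case: y => c e /=; ring. Qed.

Lemma cRe_realM (r : R) (x : R[i]) : complex.Re (r%:C * x) = r * complex.Re x.
Proof. by rewrite cReM /= mul0r subr0. Qed.

Lemma cIm_realM (r : R) (x : R[i]) : complex.Im (r%:C * x) = r * complex.Im x.
Proof. by rewrite cImM /= mul0r addr0. Qed.

Lemma Re_conjc x : complex.Re (conjc x) = complex.Re x. Proof. by case: x. Qed.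

Lemma Im_conjc x : complex.Im (conjc x) = - complex.Im x. Proof. by case: x. Qed.

Lemma complexP x y :
  complex.Re x = complex.Re y -> complex.Im x = complex.Im y -> x = y.
Proof. by case: x => a b; case: y => c e /= -> ->. Qed.

Lemma mulii : 'i * 'i = -1 :> R[i]. Proof. by rewrite -expr2 sqr_i. Qed.

Definition normsq z : R := complex.Re z ^+ 2 + complex.Im z ^+ 2.

Lemma normsqE z : (normsq z)%:C = z * conjc z.
Proof.
by case: z => a b; apply: complexP; rewrite /normsq /=; ring.
Qed.

Lemma normsqM x y : normsq (x * y) = normsq x * normsq y.
Proof. by rewrite /normsq cReM cImM; ring. Qed.

Lemma normsq_gt0 z : (0 < normsq z) = (z != 0).
Proof.
rewrite /normsq lt_neqAle addr_ge0 ?sqr_ge0 // andbT eq_sym.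
by rewrite paddr_eq0 ?sqr_ge0 // !sqrf_eq0 eq_complex.
Qed.

Lemma normsq1 : normsq 1 = 1.
Proof. by rewrite /normsq /= expr1n expr0n addr0. Qed.

Lemma normsq_real (t : R) : normsq t%:C = t ^+ 2.
Proof. by rewrite /normsq /= expr0n addr0. Qed.

Lemma conjc_neq0 z : (conjc z != 0) = (z != 0).
Proof. by rewrite conjc_eq0. Qed.

End ComplexArithmetic.

(** * Wirtinger derivatives of complex-valued functions *)

Section WirtingerCalculus.
Context {R : realType} {m : nat}.
Implicit Types (f g : Cn R m -> R[i]) (p v : Cn R m) (a b c e : R[i]) (j : 'I_m).

Definition is_cderive p v f a : Prop :=
  is_derive p v (fun q => complex.Re (f q)) (complex.Re a) /\
  is_derive p v (fun q => complex.Im (f q)) (complex.Im a).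

Definition cdiff f p : Prop :=
  differentiable (fun q => complex.Re (f q)) p /\
  differentiable (fun q => complex.Im (f q)) p.

(* [a] and [b] are the values at [p] of the derivatives of [f] along z_j and its
   conjugate; [f] need only be derivable in the two real directions of z_j. *)
Definition wirtinger j f p a b : Prop :=
  is_cderive p (ex R j) f (a + b) /\ is_cderive p (ey R j) f ('i * (a - b)).

Lemma is_cderive_val p v f a : is_cderive p v f a -> cderive v f p = a.
Proof. by case=> [[_ Da] [_ Db]]; rewrite /cderive Da Db; case: (a). Qed.

Lemma cdiff_is_cderive f p v : cdiff f p -> is_cderive p v f (cderive v f p).
Proof. by case=> fr fi; split; apply: derivableP; exact: diff_derivable. Qed.

Lemma is_cderive_near p v f g a : {near p, f =1 g} ->
  is_cderive p v f a -> is_cderive p v g a.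
Proof.
move=> fg [dr di]; split; [apply: near_eq_is_derive dr|apply: near_eq_is_derive di];
  by near=> q; congr (_ _); exact: (near fg q).
Unshelve. all: by end_near. Qed.

Lemma is_cderive_cst p v a : is_cderive p v (fun=> a) 0.
Proof. by split; exact: is_derive_cst. Qed.

Lemma is_cderiveD p v f g a b : is_cderive p v f a -> is_cderive p v g b ->
  is_cderive p v (fun q => f q + g q) (a + b).
Proof.
move=> [fr fi] [gr gi]; split; under eq_fun do rewrite ?cReD ?cImD.
- by rewrite cReD; exact: is_deriveD.
- by rewrite cImD; exact: is_deriveD.
Qed.

Lemma is_cderiveM p v f g a b : is_cderive p v f a -> is_cderive p v g b ->
  is_cderive p v (fun q => f q * g q) (a * g p + f p * b).
Proof.
move=> [fr fi] [gr gi]; split; under eq_fun do rewrite ?cReM ?cImM.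
- apply: is_derive_eq (is_deriveB (is_deriveM fr gr) (is_deriveM fi gi)) _.
  by rewrite cReD !cReM /GRing.scale /=; ring.
- apply: is_derive_eq (is_deriveD (is_deriveM fr gi) (is_deriveM fi gr)) _.
  by rewrite cImD !cImM /GRing.scale /=; ring.
Qed.

Lemma is_cderive_conj p v f a : is_cderive p v f a ->
  is_cderive p v (fun q => conjc (f q)) (conjc a).
Proof.
move=> [fr fi]; split; under eq_fun do rewrite ?Re_conjc ?Im_conjc.
- by rewrite Re_conjc.
- by rewrite Im_conjc; exact: is_deriveN.
Qed.

Lemma is_cderive_real_comp p v (g : Cn R m -> R) (F : R -> R) a (dF : R) :
  is_cderive p v (fun q => (g q)%:C) a -> is_derive (g p) 1 F dF ->
  is_cderive p v (fun q => (F (g q))%:C) (dF%:C * a).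
Proof.
move=> [gr gi] dFg; split.
- rewrite cReM /= mul0r subr0; exact: is_derive_comp1 gr dFg.
- rewrite cImM /= mul0r addr0; have [_ <-] := gi.
  have -> : 'D_v (fun q => complex.Im (g q)%:C) p = 0 by exact: derive_cst.
  by rewrite mulr0; exact: is_derive_cst.
Qed.

Lemma wirtinger_val j f p a b : wirtinger j f p a b ->
  dz j f p = a /\ dzb j f p = b.
Proof.
move=> [/is_cderive_val Dx /is_cderive_val Dy]; rewrite /dz /dzb Dx Dy mulrA mulii.
by split; field.
Qed.

Lemma wirtinger_dz j f p a b : wirtinger j f p a b -> dz j f p = a.
Proof. by case/wirtinger_val. Qed.

Lemma wirtinger_dzb j f p a b : wirtinger j f p a b -> dzb j f p = b.
Proof. by case/wirtinger_val. Qed.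

Lemma wirtinger_eq j f p a b c e :
  wirtinger j f p a b -> a = c -> b = e -> wirtinger j f p c e.
Proof. by move=> ? <- <-. Qed.

Lemma cdiff_wirtinger f p j : cdiff f p -> wirtinger j f p (dz j f p) (dzb j f p).
Proof.
move=> df; split.
- have -> : dz j f p + dzb j f p = cderive (ex R j) f p.
    by rewrite /dz /dzb; field.
  exact: cdiff_is_cderive.
- have -> : 'i * (dz j f p - dzb j f p) = cderive (ey R j) f p.
    (* [field] treats 'i as an atom, so the relation 'i * 'i = -1 is inserted by hand on the
       right-hand side. *)
    rewrite /dz /dzb -[RHS]opprK -[- cderive _ _ _]mulN1r -mulii.
    by field.
  exact: cdiff_is_cderive.
Qed.

Lemma wirtinger_near j f g p a b : {near p, f =1 g} ->
  wirtinger j f p a b -> wirtinger j g p a b.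
Proof. by move=> fg [dx dy]; split; exact: is_cderive_near fg _. Qed.

Lemma wirtinger_cst j p a : wirtinger j (fun=> a) p 0 0.
Proof. by split; rewrite ?subrr ?mulr0 ?addr0; exact: is_cderive_cst. Qed.

Lemma wirtingerD j f g p a b c e :
  wirtinger j f p a b -> wirtinger j g p c e ->
  wirtinger j (fun q => f q + g q) p (a + c) (b + e).
Proof.
move=> [fx fy] [gx gy]; split.
- by rewrite addrACA; exact: is_cderiveD.
- by rewrite opprD addrACA mulrDr; exact: is_cderiveD.
Qed.

Lemma wirtingerM j f g p a b c e :
  wirtinger j f p a b -> wirtinger j g p c e ->
  wirtinger j (fun q => f q * g q) p (a * g p + f p * c) (b * g p + f p * e).
Proof.
move=> [fx fy] [gx gy]; split.
- rewrite (_ : _ + _ + _ = (a + b) * g p + f p * (c + e)); last by ring.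
  exact: is_cderiveM.
- rewrite (_ : 'i * _ = ('i * (a - b)) * g p + f p * ('i * (c - e))); last by ring.
  exact: is_cderiveM.
Qed.

Lemma wirtingerZ j (k : R[i]) f p a b :
  wirtinger j f p a b -> wirtinger j (fun q => k * f q) p (k * a) (k * b).
Proof.
move=> wf; apply: wirtinger_eq (wirtingerM (wirtinger_cst j p k) wf) _ _;
  by rewrite mul0r add0r.
Qed.

Lemma wirtinger_conj j f p a b : wirtinger j f p a b ->
  wirtinger j (fun q => conjc (f q)) p (conjc b) (conjc a).
Proof.
move=> [fx fy]; split.
- by have := is_cderive_conj fx; rewrite rmorphD addrC.
- have := is_cderive_conj fy; rewrite rmorphM rmorphB /=.
  have -> : (-1)*i = - 'i :> R[i] by apply: complexP; rewrite //= oppr0.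
  by rewrite mulNr -mulrN opprB.
Qed.

Lemma wirtinger_real_comp j p (g : Cn R m -> R) (F : R -> R) a b (dF : R) :
  wirtinger j (fun q => (g q)%:C) p a b -> is_derive (g p) 1 F dF ->
  wirtinger j (fun q => (F (g q))%:C) p (dF%:C * a) (dF%:C * b).
Proof.
move=> [gx gy] dFg; split.
- by rewrite -mulrDr; exact: is_cderive_real_comp.
- by rewrite -mulrBr mulrCA; exact: is_cderive_real_comp.
Qed.

Lemma csmooth_cdiff U f p : csmooth_on U f -> U p -> cdiff f p.
Proof. by move=> [sr si] Up; split; [exact: (sr [::])|exact: (si [::])]. Qed.

Lemma csmooth_wirtinger U f p j : csmooth_on U f -> U p ->
  wirtinger j f p (dz j f p) (dzb j f p).
Proof. by move=> sf Up; apply: cdiff_wirtinger; exact: csmooth_cdiff Up. Qed.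

Lemma cderive_near v f g p : {near p, f =1 g} -> cderive v f p = cderive v g p.
Proof.
by move=> fg; congr (_ +i* _); apply: near_eq_derive; near=> q; congr (_ _);
  exact: (near fg q).
Unshelve. all: by end_near. Qed.

Lemma dz_near j f g p : {near p, f =1 g} -> dz j f p = dz j g p.
Proof. by move=> fg; rewrite /dz !(cderive_near _ fg). Qed.

Lemma dzb_near j f g p : {near p, f =1 g} -> dzb j f p = dzb j g p.
Proof. by move=> fg; rewrite /dzb !(cderive_near _ fg). Qed.

Section CsmoothClosure.
Variables (U : set (Cn R m)) (oU : open U).

Lemma eq_csmooth f g : (forall p, U p -> f p = g p) ->
  csmooth_on U f -> csmooth_on U g.
Proof.
move=> fg [sr si]; split; [apply: eq_smooth_on sr|apply: eq_smooth_on si] => // p Up;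
  by rewrite fg.
Qed.

Lemma csmooth_cst a : csmooth_on U (fun=> a).
Proof. by split; exact: smooth_on_cst. Qed.

Lemma csmooth_real (f : Cn R m -> R) : smooth_on U f -> csmooth_on U (fun p => (f p)%:C).
Proof. by move=> sf; split=> //=; exact: smooth_on_cst. Qed.

Lemma csmoothD f g :
  csmooth_on U f -> csmooth_on U g -> csmooth_on U (fun p => f p + g p).
Proof.
by move=> [fr fi] [gr gi]; split; under eq_fun do rewrite ?cReD ?cImD; exact: smooth_onD.
Qed.

Lemma csmoothM f g :
  csmooth_on U f -> csmooth_on U g -> csmooth_on U (fun p => f p * g p).
Proof.
move=> [fr fi] [gr gi]; split; under eq_fun do rewrite ?cReM ?cImM.
- apply: smooth_onD => //; first exact: smooth_onM.
  by apply: smooth_onN => //; exact: smooth_onM.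
- by apply: smooth_onD => //; exact: smooth_onM.
Qed.

Lemma csmoothZ (k : R[i]) f : csmooth_on U f -> csmooth_on U (fun p => k * f p).
Proof. by move=> sf; apply: csmoothM => //; exact: csmooth_cst. Qed.

Lemma csmooth_cderive v f : csmooth_on U f -> csmooth_on U (cderive v f).
Proof. by move=> [fr fi]; split; exact: smooth_on_derive. Qed.

Lemma csmooth_dz j f : csmooth_on U f -> csmooth_on U (dz j f).
Proof.
move=> sf; apply: (@eq_csmooth (fun p => 2^-1 * (cderive (ex R j) f p +
    (- 'i) * cderive (ey R j) f p))).
  by move=> p _; rewrite /dz mulNr mulrC.
by apply: csmoothZ; apply: csmoothD; [|apply: csmoothZ]; exact: csmooth_cderive.
Qed.

Lemma csmooth_dzb j f : csmooth_on U f -> csmooth_on U (dzb j f).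
Proof.
move=> sf; apply: (@eq_csmooth (fun p => 2^-1 * (cderive (ex R j) f p +
    'i * cderive (ey R j) f p))).
  by move=> p _; rewrite /dzb mulrC.
by apply: csmoothZ; apply: csmoothD; [|apply: csmoothZ]; exact: csmooth_cderive.
Qed.

End CsmoothClosure.

End WirtingerCalculus.

(** * Splitting C^(1+d) into fibre and base coordinates *)

Section FiberBaseCoordinates.
Context {R : realType} {d : nat}.
Implicit Types (z c : R[i]) (w : Cn R d) (p q v : Cn R (1 + d)) (k : R).

Definition mkpt z w : Cn R (1 + d) :=
  (row_mx (complex.Re z)%:M w.1, row_mx (complex.Im z)%:M w.2).

Lemma fiber_mkpt z w : fiber (mkpt z w) = z.
Proof. by rewrite /fiber /zcoord /= !row_mxEl !mxE !eqxx !mulr1n; case: z. Qed.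

Lemma base_mkpt z w : base (mkpt z w) = w.
Proof. by rewrite /base /= !row_mxKr; case: w. Qed.

Lemma mkpt_fiber_base p : mkpt (fiber p) (base p) = p.
Proof.
case: p => p1 p2; rewrite /mkpt /base /=; congr (_, _);
  rewrite -[RHS]hsubmxK; congr row_mx; apply/matrixP => i j; rewrite !mxE !ord1 eqxx mulr1n;
  congr (_ _ _); exact: val_inj.
Qed.

Lemma fiber_linear (t : R) v p : fiber (t *: v + p) = t%:C * fiber v + fiber p.
Proof.
by apply: complexP; rewrite /fiber /zcoord /= ?mul0r ?subr0 ?addr0 !mxE.
Qed.

Lemma base_linear (t : R) v p : base (t *: v + p) = t *: base v + base p.
Proof. by rewrite /base /= !linearP. Qed.

Lemma mkpt_linear (t : R) z z' w w' :
  mkpt (t%:C * z + z') (t *: w + w') = t *: mkpt z w + mkpt z' w'.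
Proof.
rewrite -[RHS]mkpt_fiber_base fiber_linear base_linear.
by rewrite !fiber_mkpt !base_mkpt.
Qed.

Lemma fiber_ex0 : fiber (ex R (lshift d 0)) = 1.
Proof. by rewrite /fiber /zcoord /= !mxE !eqxx. Qed.

Lemma fiber_ey0 : fiber (ey R (lshift d 0)) = 'i.
Proof. by rewrite /fiber /zcoord /= !mxE !eqxx. Qed.

Lemma base_ex0 : base (ex R (lshift d 0)) = 0.
Proof.
by rewrite /base /=; congr (_, _); apply/rowP => j; rewrite !mxE // eq_rlshift andbF.
Qed.

Lemma base_ey0 : base (ey R (lshift d 0)) = 0.
Proof.
by rewrite /base /=; congr (_, _); apply/rowP => j; rewrite !mxE // eq_rlshift andbF.
Qed.

Lemma fiber_exS (j : 'I_d) : fiber (ex R (rshift 1 j)) = 0.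
Proof. by rewrite /fiber /zcoord /= !mxE eq_lrshift andbF. Qed.

Lemma fiber_eyS (j : 'I_d) : fiber (ey R (rshift 1 j)) = 0.
Proof. by rewrite /fiber /zcoord /= !mxE eq_lrshift andbF. Qed.

Lemma base_exS (j : 'I_d) : base (ex R (rshift 1 j)) = ex R j.
Proof.
by rewrite /base /=; congr (_, _); apply/rowP => i; rewrite !mxE // eq_rshift.
Qed.

Lemma base_eyS (j : 'I_d) : base (ey R (rshift 1 j)) = ey R j.
Proof.
by rewrite /base /=; congr (_, _); apply/rowP => i; rewrite !mxE // eq_rshift.
Qed.

Lemma ex0E : ex R (lshift d 0) = mkpt 1 0.
Proof. by rewrite -[LHS]mkpt_fiber_base fiber_ex0 base_ex0. Qed.

Lemma ey0E : ey R (lshift d 0) = mkpt 'i 0.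
Proof. by rewrite -[LHS]mkpt_fiber_base fiber_ey0 base_ey0. Qed.

Lemma exSE (j : 'I_d) : ex R (rshift 1 j) = mkpt 0 (ex R j).
Proof. by rewrite -[LHS]mkpt_fiber_base fiber_exS base_exS. Qed.

Lemma eySE (j : 'I_d) : ey R (rshift 1 j) = mkpt 0 (ey R j).
Proof. by rewrite -[LHS]mkpt_fiber_base fiber_eyS base_eyS. Qed.

End FiberBaseCoordinates.

(** * Differentiability of the coordinate maps and of fibrewise multiplication *)

Section Differentiability.
Context {R : realType}.

Lemma differentiable_rowP (W : normedModType R) n (L : W -> 'rV[R]_n) q :
  (forall j, differentiable (fun x => L x 0 j) q) -> differentiable L q.
Proof.
move=> dL; have -> : L = \sum_(j < n) (fun x => L x 0 j *: (delta_mx 0 j : 'rV[R]_n)).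
  by apply/funext => x; rewrite fct_sumE -row_sum_delta.
by apply: differentiable_sum => j; exact: differentiableZl.
Qed.

Lemma differentiable_Cn (W : normedModType R) n (L : W -> Cn R n) q :
  (forall j, differentiable (fun x => (L x).1 0 j) q) ->
  (forall j, differentiable (fun x => (L x).2 0 j) q) -> differentiable L q.
Proof.
move=> d1 d2; have -> : L = (fun x => ((L x).1, (L x).2)).
  by apply/funext => x; case: (L x).
by apply: differentiable_pair; apply: differentiable_rowP.
Qed.

Lemma differentiable_coord1 n (j : 'I_n) (p : Cn R n) :
  differentiable (fun q : Cn R n => q.1 0 j) p.
Proof.
apply: (@differentiable_comp _ _ _ _ (fst : Cn R n -> _) (fun v : 'rV_n => v 0 j)).
  by apply: linear_differentiable => q; exact: cvg_fst.
exact: differentiable_coord.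
Qed.

Lemma differentiable_coord2 n (j : 'I_n) (p : Cn R n) :
  differentiable (fun q : Cn R n => q.2 0 j) p.
Proof.
apply: (@differentiable_comp _ _ _ _ (snd : Cn R n -> _) (fun v : 'rV_n => v 0 j)).
  by apply: linear_differentiable => q; exact: cvg_snd.
exact: differentiable_coord.
Qed.

Context {d : nat}.

Lemma differentiable_Re_fiber (p : Cn R (1 + d)) :
  differentiable (fun q : Cn R (1 + d) => complex.Re (fiber q)) p.
Proof. exact: differentiable_coord1. Qed.

Lemma differentiable_Im_fiber (p : Cn R (1 + d)) :
  differentiable (fun q : Cn R (1 + d) => complex.Im (fiber q)) p.
Proof. exact: differentiable_coord2. Qed.

Lemma differentiable_base (p : Cn R (1 + d)) : differentiable (@base R d) p.
Proof.
apply: differentiable_Cn => j; under eq_fun do rewrite /= mxE;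
  [exact: differentiable_coord1|exact: differentiable_coord2].
Qed.

Lemma differentiable_mkpt (W : normedModType R) (Z : W -> R[i]) (B : W -> Cn R d) q :
  differentiable (fun x => complex.Re (Z x)) q ->
  differentiable (fun x => complex.Im (Z x)) q ->
  differentiable B q -> differentiable (fun x => mkpt (Z x) (B x)) q.
Proof.
move=> dr di dB; apply: differentiable_Cn => j; case: (split_ordP j) => i ->.
- have -> : i = 0 by rewrite ord1.
  by under eq_fun do rewrite /= row_mxEl mxE eqxx mulr1n.
- under eq_fun do rewrite /= row_mxEr.
  exact: (differentiable_comp dB (differentiable_coord1 _ _)).
- have -> : i = 0 by rewrite ord1.
  by under eq_fun do rewrite /= row_mxEl mxE eqxx mulr1n.
- under eq_fun do rewrite /= row_mxEr.
  exact: (differentiable_comp dB (differentiable_coord2 _ _)).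
Qed.

Lemma differentiable_mkpt_base (z : R[i]) (w : Cn R d) :
  differentiable (mkpt z : Cn R d -> Cn R (1 + d)) w.
Proof. exact: differentiable_mkpt. Qed.

(** Here [c] is arbitrary: unit [c] gives the circle action, and [c = expR t] gives the flow of the
    real field V. *)
Definition rotate (c : R[i]) (p : Cn R (1 + d)) : Cn R (1 + d) :=
  mkpt (c * fiber p) (base p).

Lemma rotate_linear c (t : R) v p :
  rotate c (t *: v + p) = t *: rotate c v + rotate c p.
Proof. by rewrite /rotate fiber_linear base_linear mulrDr mulrCA mkpt_linear. Qed.

Lemma differentiable_rotate c p : differentiable (rotate c) p.
Proof.
apply: differentiable_mkpt; last exact: differentiable_base.
- under eq_fun do rewrite cReM; apply: differentiableB; apply: differentiableM => //;
    [exact: differentiable_Re_fiber|exact: differentiable_Im_fiber].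
- under eq_fun do rewrite cImM; apply: differentiableD; apply: differentiableM => //;
    [exact: differentiable_Im_fiber|exact: differentiable_Re_fiber].
Qed.

End Differentiability.

(** * Derivatives of base functions, of log |z|^2 and of |z|^(2k) *)

Section WirtingerFiberBase.
Context {R : realType} {d : nat}.
Implicit Types (z c : R[i]) (w : Cn R d) (p q v : Cn R (1 + d)) (k : R).
Local Notation l0 := (lshift d 0).
Local Notation rs := (rshift 1).

Lemma is_cderive_affine n n' (L l : Cn R n -> Cn R n')
    (f : Cn R n' -> R[i]) (q v : Cn R n) a :
  (forall (t : R) (v q : Cn R n), L (t *: v + q) = t *: l v + L q) ->
  is_cderive (L q) (l v) f a -> is_cderive q v (fun x => f (L x)) a.
Proof.
move=> HL [[dr Dr] [di Di]]; split; apply: DeriveDef.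
- by rewrite (derivable_affine (fun x => complex.Re (f x)) q v HL).
- by rewrite (derive_affine (fun x => complex.Re (f x)) q v HL).
- by rewrite (derivable_affine (fun x => complex.Im (f x)) q v HL).
- by rewrite (derive_affine (fun x => complex.Im (f x)) q v HL).
Qed.

Lemma cderive_affine n n' (L l : Cn R n -> Cn R n')
    (f : Cn R n' -> R[i]) (q v : Cn R n) :
  (forall (t : R) (v q : Cn R n), L (t *: v + q) = t *: l v + L q) ->
  cderive v (fun x => f (L x)) q = cderive (l v) f (L q).
Proof.
move=> HL; congr (_ +i* _).
- exact: (derive_affine (fun x => complex.Re (f x)) q v HL).
- exact: (derive_affine (fun x => complex.Im (f x)) q v HL).
Qed.

Lemma is_cderive0 n f (p : Cn R n) : is_cderive p 0 f 0.
Proof. by split; exact: is_derive0. Qed.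

Lemma is_cderive_fiber p v : is_cderive p v (@fiber R d) (fiber v).
Proof.
split; apply: DeriveDef.
- exact/diff_derivable/differentiable_Re_fiber.
- rewrite (@derive_affine R R _ (fun x => complex.Re (fiber x))
    (fun x => complex.Re (fiber x)) id) ?derive_id //.
  by move=> t v' q'; rewrite fiber_linear cReD cReM /= mul0r subr0.
- exact/diff_derivable/differentiable_Im_fiber.
- rewrite (@derive_affine R R _ (fun x => complex.Im (fiber x))
    (fun x => complex.Im (fiber x)) id) ?derive_id //.
  by move=> t v' q'; rewrite fiber_linear cImD cImM /= mul0r addr0.
Qed.

Lemma wirtinger_fiber0 p : wirtinger l0 (@fiber R d) p 1 0.
Proof.
split; rewrite ?addr0 ?subr0 ?mulr1.
- by have := is_cderive_fiber p (ex R l0); rewrite fiber_ex0.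
- by have := is_cderive_fiber p (ey R l0); rewrite fiber_ey0.
Qed.

Lemma wirtinger_fiberS p (j : 'I_d) : wirtinger (rs j) (@fiber R d) p 0 0.
Proof.
split; rewrite ?addr0 ?subr0 ?mulr0.
- by have := is_cderive_fiber p (ex R (rs j)); rewrite fiber_exS.
- by have := is_cderive_fiber p (ey R (rs j)); rewrite fiber_eyS.
Qed.

(** The function is constant along both real fibre directions, so [a] may be arbitrary. Fibre
    derivatives of |z|^(2k) a(w) are therefore available before [a] is known to be smooth. *)
Lemma wirtinger_base0 (a : Cn R d -> R[i]) p : wirtinger l0 (fun q => a (base q)) p 0 0.
Proof.
split; rewrite ?addr0 ?subr0 ?mulr0; apply: (is_cderive_affine base_linear).
- by rewrite base_ex0; exact: is_cderive0.
- by rewrite base_ey0; exact: is_cderive0.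
Qed.

Lemma wirtinger_baseS (a : Cn R d -> R[i]) p (j : 'I_d) b c :
  wirtinger j a (base p) b c -> wirtinger (rs j) (fun q => a (base q)) p b c.
Proof.
move=> [dx dy]; split; apply: (is_cderive_affine base_linear).
- by rewrite base_exS.
- by rewrite base_eyS.
Qed.

Lemma mkpt_base_linear z (t : R) (v q : Cn R d) :
  mkpt z (t *: v + q) = t *: mkpt 0 v + mkpt z q.
Proof. by rewrite -mkpt_linear mulr0 add0r. Qed.

Lemma dz_slice (f : Cn R (1 + d) -> R[i]) z w (j : 'I_d) :
  dz (rs j) f (mkpt z w) = dz j (fun w' => f (mkpt z w')) w.
Proof. by rewrite /dz !(cderive_affine _ _ _ (mkpt_base_linear z)) exSE eySE. Qed.

Lemma dzb_slice (f : Cn R (1 + d) -> R[i]) z w (j : 'I_d) :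
  dzb (rs j) f (mkpt z w) = dzb j (fun w' => f (mkpt z w')) w.
Proof. by rewrite /dzb !(cderive_affine _ _ _ (mkpt_base_linear z)) exSE eySE. Qed.

(* |z|^(2k) for [z] nonzero. *)
Definition rho k z : R := expR (k * ln (normsq z)).

Lemma rho_gt0 k z : 0 < rho k z. Proof. exact: expR_gt0. Qed.

Lemma rhoC_neq0 k z : (rho k z)%:C != 0.
Proof. by rewrite eq_complex /= gt_eqF // rho_gt0. Qed.

Lemma rhoD k k' z : rho (k + k') z = rho k z * rho k' z.
Proof. by rewrite /rho mulrDl expRD. Qed.

Lemma rho0 z : rho 0 z = 1. Proof. by rewrite /rho mul0r expR0. Qed.

Lemma rho1 z : z != 0 -> rho 1 z = normsq z.
Proof. by move=> z0; rewrite /rho mul1r lnK // posrE normsq_gt0. Qed.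

Lemma rho_of1 k : rho k 1 = 1.
Proof. by rewrite /rho normsq1 ln1 mulr0 expR0. Qed.

Lemma rho_unit k c : normsq c = 1 -> rho k c = 1.
Proof. by rewrite /rho => ->; rewrite ln1 mulr0 expR0. Qed.

Lemma rhoM k c z : c != 0 -> z != 0 -> rho k (c * z) = rho k c * rho k z.
Proof.
by move=> c0 z0; rewrite /rho normsqM lnM ?posrE ?normsq_gt0 // mulrDr expRD.
Qed.

Lemma rhoN k z : rho (- k) z = (rho k z)^-1.
Proof. by rewrite /rho mulNr expRN. Qed.

Lemma rhoXn k z n : rho k z ^+ n = rho (n%:R * k) z.
Proof. by rewrite /rho -expRM_natl mulrA. Qed.

Lemma rhoC_pred k z : z != 0 -> (rho k z)%:C = (rho (k - 1) z)%:C * (z * conjc z).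
Proof. by move=> z0; rewrite -normsqE -rho1 // -rmorphM -rhoD subrK. Qed.

Lemma wirtinger_ln0 p : fiber p != 0 ->
  wirtinger l0 (fun q => (ln (normsq (fiber q)))%:C) p (fiber p)^-1 (conjc (fiber p))^-1.
Proof.
move=> z0; have w1 := wirtinger_fiber0 p.
have w2 : wirtinger l0 (fun q => (normsq (fiber q))%:C) p (conjc (fiber p)) (fiber p).
  have := wirtingerM w1 (wirtinger_conj w1).
  by under eq_fun do rewrite -normsqE; rewrite conjc0 conjc1 mul1r mulr0 addr0 mulr1 mul0r add0r.
have n0 : 0 < normsq (fiber p) by rewrite normsq_gt0.
have cz0 : conjc (fiber p) != 0 by rewrite conjc_neq0.
apply: wirtinger_eq (wirtinger_real_comp w2 (is_derive1_ln n0)) _ _;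
  rewrite fmorphV /= normsqE invfM.
- by rewrite mulfVK.
- by rewrite mulrAC mulVf // mul1r.
Qed.

Lemma wirtinger_lnS p (j : 'I_d) : fiber p != 0 ->
  wirtinger (rs j) (fun q => (ln (normsq (fiber q)))%:C) p 0 0.
Proof.
move=> z0; have w1 := wirtinger_fiberS p j.
have w2 : wirtinger (rs j) (fun q => (normsq (fiber q))%:C) p 0 0.
  have := wirtingerM w1 (wirtinger_conj w1).
  by under eq_fun do rewrite -normsqE; rewrite conjc0 !mulr0 !mul0r addr0.
have n0 : 0 < normsq (fiber p) by rewrite normsq_gt0.
by apply: wirtinger_eq (wirtinger_real_comp w2 (is_derive1_ln n0)) _ _; rewrite mulr0.
Qed.

Lemma is_derive_expRZ k (x : R) : is_derive x 1 (fun t => expR (k * t)) (k * expR (k * x)).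
Proof.
have h : is_derive x 1 ( *%R k) k.
  by apply: is_derive_eq (is_deriveZ k (is_derive_id x 1)) _; rewrite /GRing.scale /= mulr1.
by apply: is_derive_eq (is_derive1_comp (is_derive_expR (k * x)) h) _; rewrite mulrC.
Qed.

Lemma wirtinger_rho0 k p : fiber p != 0 ->
  wirtinger l0 (fun q => (rho k (fiber q))%:C) p
    (k%:C * (rho k (fiber p))%:C / fiber p)
    (k%:C * (rho k (fiber p))%:C / conjc (fiber p)).
Proof.
move=> z0.
apply: wirtinger_eq (wirtinger_real_comp (wirtinger_ln0 z0) (is_derive_expRZ k _)) _ _;
  by rewrite rmorphM.
Qed.

Lemma wirtinger_rhoS k p (j : 'I_d) : fiber p != 0 ->
  wirtinger (rs j) (fun q => (rho k (fiber q))%:C) p 0 0.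
Proof.
move=> z0.
by apply: wirtinger_eq (wirtinger_real_comp (wirtinger_lnS j z0) (is_derive_expRZ k _)) _ _;
  rewrite mulr0.
Qed.

End WirtingerFiberBase.

#[local] Arguments conjc : simpl never.
#[local] Arguments fiber : simpl never.

(** * The coframe (dz/z, dw) *)

Section FiberScaling.
Context {R : realType} {d : nat}.
Implicit Types (z c : R[i]).

Definition fiber_coef z (i : 'I_(1 + d)) : R[i] := if i == lshift d 0 then z^-1 else 1.

(* In the coframe (dz/z, dw) a form of weight [2 * k] has coefficients
   [|z|^(2k)] times functions of [w]; [coframe z] and [coframe_conj z] are the
   changes of coframe. *)
Definition coframe z : 'M[R[i]]_(1 + d) := diag_mx (\row_i fiber_coef z i).
Definition coframe_conj z : 'M[R[i]]_(1 + d) := diag_mx (\row_i conjc (fiber_coef z i)).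

Lemma fiber_coef0 z : fiber_coef z (lshift d 0) = z^-1.
Proof. by rewrite /fiber_coef eqxx. Qed.

Lemma fiber_coefS z (j : 'I_d) : fiber_coef z (rshift 1 j) = 1.
Proof. by rewrite /fiber_coef eq_rlshift. Qed.

Lemma coframe_mulE z (A : 'M[R[i]]_(1 + d)) i j :
  (coframe z *m A *m coframe_conj z) i j =
  fiber_coef z i * A i j * conjc (fiber_coef z j).
Proof. by rewrite mul_mx_diag mxE mul_diag_mx !mxE. Qed.

Lemma det_coframe z : \det (coframe z) = z^-1.
Proof.
rewrite det_diag big_split_ord /= big_ord1 mxE fiber_coef0 big1 ?mulr1 // => j _.
by rewrite mxE fiber_coefS.
Qed.

Lemma det_coframe_conj z : \det (coframe_conj z) = (conjc z)^-1.
Proof.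
rewrite det_diag big_split_ord /= big_ord1 mxE fiber_coef0 big1 ?mulr1 ?fmorphV // => j _.
by rewrite mxE fiber_coefS conjc1.
Qed.

Lemma coframe_unit z : z != 0 -> coframe z \in unitmx.
Proof. by move=> z0; rewrite unitmxE det_coframe unitfE invr_eq0. Qed.

Lemma coframe_conj_unit z : z != 0 -> coframe_conj z \in unitmx.
Proof. by move=> z0; rewrite unitmxE det_coframe_conj unitfE invr_eq0 conjc_neq0. Qed.

End FiberScaling.

(** * Complex Hessians of |z|^(2k) a(w) and of k log |z|^2 + b(w) *)

Section HomogeneousFunctions.
Context {R : realType} {d : nat}.
Implicit Types (z c : R[i]) (w : Cn R d) (p q v : Cn R (1 + d)).
Local Notation l0 := (lshift d 0).
Local Notation rs := (rshift 1).

Definition punctured (U : set (Cn R d)) : set (Cn R (1 + d)) :=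
  [set p | U (base p) /\ fiber p != 0].

Lemma open_punctured (U : set (Cn R d)) : open U -> open (punctured U).
Proof.
move=> oU; have -> : punctured U =
    (@base R d) @^-1` U `&` (fun p => normsq (fiber p)) @^-1` [set x | 0 < x].
  by apply/seteqP; split=> p; rewrite /punctured /= normsq_gt0.
apply: openI.
  apply: open_comp => // p _.
  exact/differentiable_continuous/differentiable_base.
apply: open_comp; last exact: open_gt.
move=> p _; apply: differentiable_continuous; rewrite /normsq.
under eq_fun do rewrite !expr2.
apply: differentiableD; apply: differentiableM;
  by [exact: differentiable_Re_fiber|exact: differentiable_Im_fiber].
Qed.

Lemma sum_Vhol p (G : 'I_(1 + d) -> R[i]) : \sum_k Vhol k p * G k = fiber p * G l0.
Proof.
rewrite big_split_ord /= big_ord1 /Vhol eqxx big1 ?addr0 // => j _.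
by rewrite eq_rlshift mul0r.
Qed.

Lemma sum_conj_Vhol p (G : 'I_(1 + d) -> R[i]) :
  \sum_k conjc (Vhol k p) * G k = conjc (fiber p) * G l0.
Proof.
rewrite big_split_ord /= big_ord1 /Vhol eqxx big1 ?addr0 // => j _.
by rewrite (negPf (_ : rshift 1 j != l0)) ?eq_rlshift // conjc0 mul0r.
Qed.

Section Homogeneous.
Variables (U : set (Cn R d)) (oU : open U) (k : R).
Variables (f : Cn R (1 + d) -> R[i]) (a : Cn R d -> R[i]).
Hypothesis fE : forall z w, U w -> z != 0 -> f (mkpt z w) = (rho k z)%:C * a w.

Lemma homog_near p : punctured U p ->
  {near p, (fun q => (rho k (fiber q))%:C * a (base q)) =1 f}.
Proof.
move=> Wp; apply: (@filterS _ _ _ (punctured U)); last first.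
  exact: open_nbhs_nbhs (conj (open_punctured oU) Wp).
by move=> q [Uq zq] /=; rewrite -fE // mkpt_fiber_base.
Qed.

Lemma homog_wirtinger0 p : punctured U p ->
  wirtinger l0 f p (k%:C * (rho k (fiber p))%:C / fiber p * a (base p))
    (k%:C * (rho k (fiber p))%:C / conjc (fiber p) * a (base p)).
Proof.
move=> Wp; apply: wirtinger_near (homog_near Wp) _; have [_ z0] := Wp.
apply: wirtinger_eq (wirtingerM (wirtinger_rho0 k z0) (wirtinger_base0 a p)) _ _;
  by rewrite mulr0 addr0.
Qed.

Lemma homog_lie_fun p : punctured U p -> lie_fun (@Vhol R d) f p = (2 * k)%:C * f p.
Proof.
move=> Wp; rewrite /lie_fun big_split /= sum_Vhol sum_conj_Vhol.
have [-> ->] := wirtinger_val (homog_wirtinger0 Wp); have [Up z0] := Wp.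
have -> : f p = (rho k (fiber p))%:C * a (base p).
  by rewrite -fE // mkpt_fiber_base.
have cz0 : conjc (fiber p) != 0 by rewrite conjc_neq0.
by rewrite rmorphM rmorph_nat; field; rewrite ?z0 ?cz0.
Qed.

(** Taking a factor z zbar out of |z|^(2k) removes the denominator zbar, so that the next derivative
    only meets products. *)
Lemma homog_dzb0_near p : punctured U p ->
  {near p, (fun q => k%:C * (fiber q * (rho (k - 1) (fiber q))%:C * a (base q)))
     =1 dzb l0 f}.
Proof.
move=> Wp; apply: (@filterS _ _ _ (punctured U)); last first.
  exact: open_nbhs_nbhs (conj (open_punctured oU) Wp).
move=> q Wq /=; have [_ ->] := wirtinger_val (homog_wirtinger0 Wq).
have [Uq z0] := Wq; rewrite (rhoC_pred k z0).
have cz0 : conjc (fiber q) != 0 by rewrite conjc_neq0.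
by field.
Qed.

(** Both derivatives are along the fibre, where [a (base q)] is constant, so nothing is asked of
    [a]. [csmooth_trlog] reads this identity backwards to obtain the smoothness of [a]. *)
Lemma homog_ddb00 p : punctured U p ->
  ddb f p l0 l0 = k%:C ^+ 2 * (rho k (fiber p))%:C / (fiber p * conjc (fiber p)) * a (base p).
Proof.
move=> Wp; rewrite mxE -(dz_near _ (homog_dzb0_near Wp)); have [Up z0] := Wp.
have := wirtingerZ k%:C (wirtingerM (wirtingerM (wirtinger_fiber0 p) (wirtinger_rho0 (k - 1) z0))
  (wirtinger_base0 a p)).
move=> /wirtinger_dz ->; rewrite (rhoC_pred k z0) rmorphB rmorph1.
have cz0 : conjc (fiber p) != 0 by rewrite conjc_neq0.
by field; rewrite ?z0 ?cz0.
Qed.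

Section SmoothCoefficient.
Hypothesis sa : csmooth_on U a.

Lemma homog_wirtingerS p (j : 'I_d) : punctured U p ->
  wirtinger (rs j) f p ((rho k (fiber p))%:C * dz j a (base p))
    ((rho k (fiber p))%:C * dzb j a (base p)).
Proof.
move=> Wp; apply: wirtinger_near (homog_near Wp) _; have [Up z0] := Wp.
apply: wirtinger_eq (wirtingerM (wirtinger_rhoS k j z0)
  (wirtinger_baseS (csmooth_wirtinger j sa Up))) _ _;
  by rewrite mul0r add0r.
Qed.

Lemma homog_dzbS_near p (j : 'I_d) : punctured U p ->
  {near p, (fun q => (rho k (fiber q))%:C * dzb j a (base q)) =1 dzb (rs j) f}.
Proof.
move=> Wp; apply: (@filterS _ _ _ (punctured U)); last first.
  exact: open_nbhs_nbhs (conj (open_punctured oU) Wp).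
by move=> q Wq /=; have [_ ->] := wirtinger_val (homog_wirtingerS j Wq).
Qed.

Lemma homog_ddb0S p (j : 'I_d) : punctured U p ->
  ddb f p l0 (rs j) = k%:C * (rho k (fiber p))%:C / fiber p * dzb j a (base p).
Proof.
move=> Wp; rewrite mxE -(dz_near _ (homog_dzbS_near j Wp)); have [Up z0] := Wp.
have := wirtingerM (wirtinger_rho0 k z0) (wirtinger_base0 (dzb j a) p).
by move=> /wirtinger_dz ->; rewrite mulr0 addr0.
Qed.

Lemma homog_ddbS0 p (i : 'I_d) : punctured U p ->
  ddb f p (rs i) l0 = k%:C * (rho k (fiber p))%:C / conjc (fiber p) * dz i a (base p).
Proof.
move=> Wp; rewrite mxE -(dz_near _ (homog_dzb0_near Wp)); have [Up z0] := Wp.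
have := wirtingerZ k%:C (wirtingerM
  (wirtingerM (wirtinger_fiberS p i) (wirtinger_rhoS (k - 1) i z0))
  (wirtinger_baseS (csmooth_wirtinger i sa Up))).
move=> /wirtinger_dz ->; rewrite (rhoC_pred k z0).
have cz0 : conjc (fiber p) != 0 by rewrite conjc_neq0.
by field.
Qed.

Lemma homog_ddbSS p (i j : 'I_d) : punctured U p ->
  ddb f p (rs i) (rs j) = (rho k (fiber p))%:C * ddb a (base p) i j.
Proof.
move=> Wp; rewrite !mxE -(dz_near _ (homog_dzbS_near j Wp)); have [Up z0] := Wp.
have := wirtingerM (wirtinger_rhoS k i z0)
  (wirtinger_baseS (csmooth_wirtinger i (csmooth_dzb oU j sa) Up)).
by move=> /wirtinger_dz ->; rewrite mul0r add0r.
Qed.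

(** In each of the four blocks the dependence on z is |z|^(2k), with a factor 1/z for a fibre row
    index and 1/zbar for a fibre column index; the value at z = 1 supplies the remaining function of
    w. *)
Lemma homog_ddb z w : U w -> z != 0 ->
  ddb f (mkpt z w) = (rho k z)%:C *: (coframe z *m ddb f (mkpt 1 w) *m coframe_conj z).
Proof.
move=> Uw z0.
have Wz : punctured U (mkpt z w) by rewrite /punctured /= base_mkpt fiber_mkpt.
have W1 : punctured U (mkpt 1 w).
  by rewrite /punctured /= base_mkpt fiber_mkpt oner_eq0.
have cz0 : conjc z != 0 by rewrite conjc_neq0.
apply/matrixP => i j; rewrite [RHS]mxE coframe_mulE.
case: (split_ordP i) => i' ->; case: (split_ordP j) => j' ->; rewrite ?ord1.
- rewrite [LHS](homog_ddb00 Wz) [X in _ * (_ * X * _)](homog_ddb00 W1) !base_mkpt !fiber_mkpt !fiber_coef0 rho_of1 conjc1 conjc_inv.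
  by field; rewrite ?z0 ?cz0.
- rewrite [LHS](homog_ddb0S j' Wz) [X in _ * (_ * X * _)](homog_ddb0S j' W1) !base_mkpt !fiber_mkpt !fiber_coef0 fiber_coefS rho_of1 conjc1.
  by field.
- rewrite [LHS](homog_ddbS0 i' Wz) [X in _ * (_ * X * _)](homog_ddbS0 i' W1) !base_mkpt !fiber_mkpt !fiber_coef0 fiber_coefS rho_of1 conjc1 conjc_inv.
  by field.
- rewrite [LHS](homog_ddbSS i' j' Wz) [X in _ * (_ * X * _)](homog_ddbSS i' j' W1) !base_mkpt !fiber_mkpt !fiber_coefS rho_of1 conjc1.
  by rewrite !mul1r mulr1.
Qed.

(** The operator z d/dz multiplies |z|^(2k) a(w) by k, and it commutes with dbar because its
    coefficient is holomorphic. *)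
Lemma homog_iprod p j : punctured U p ->
  iprod (@Vhol R d) (ddb f) p j = 'i * (k%:C * dzb j f p).
Proof.
move=> Wp; rewrite /iprod sum_Vhol; congr (_ * _); have [_ z0] := Wp.
have cz0 : conjc (fiber p) != 0 by rewrite conjc_neq0.
case: (split_ordP j) => j' ->; rewrite ?ord1.
- rewrite homog_ddb00 // (wirtinger_dzb (homog_wirtinger0 Wp)).
  by field; rewrite ?z0 ?cz0.
- rewrite homog_ddb0S // (wirtinger_dzb (homog_wirtingerS j' Wp)).
  by field.
Qed.

End SmoothCoefficient.
End Homogeneous.

Lemma derive_addr (V : normedModType R) (v x : V) (g : V -> R) (c : R) :
  'D_v (fun y => c + g y) x = 'D_v g x.
Proof.
by rewrite /derive; under eq_fun do rewrite /= opprD addrACA subrr add0r.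
Qed.

(** The constant cancels in the difference quotient even when [g] has no derivative; this lets [b]
    below be an arbitrary function. *)
Lemma cderive_addr n (v x : Cn R n) (g : Cn R n -> R[i]) c :
  cderive v (fun y => c + g y) x = cderive v g x.
Proof.
rewrite /cderive; congr (_ +i* _).
- by under eq_fun do rewrite cReD; rewrite derive_addr.
- by under eq_fun do rewrite cImD; rewrite derive_addr.
Qed.

Section LogHomogeneous.
Variables (U : set (Cn R d)) (oU : open U) (k : R).
Variables (f : Cn R (1 + d) -> R[i]) (b : Cn R d -> R[i]).
Hypothesis fE : forall z w, U w -> z != 0 ->
  f (mkpt z w) = k%:C * (ln (normsq z))%:C + b w.

Lemma loghomog_dzb0_near p : punctured U p ->
  {near p, (fun q => k%:C * (fiber q * (rho (-1) (fiber q))%:C)) =1 dzb l0 f}.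
Proof.
move=> Wp; apply: (@filterS _ _ _ (punctured U)); last first.
  exact: open_nbhs_nbhs (conj (open_punctured oU) Wp).
move=> q Wq /=; have [Uq z0] := Wq.
have fq : {near q, (fun x => k%:C * (ln (normsq (fiber x)))%:C + b (base x)) =1 f}.
  apply: (@filterS _ _ _ (punctured U)); last first.
    exact: open_nbhs_nbhs (conj (open_punctured oU) Wq).
  by move=> x [Ux zx] /=; rewrite -fE // mkpt_fiber_base.
rewrite -(dzb_near _ fq).
have := wirtingerD (wirtingerZ k%:C (wirtinger_ln0 z0)) (wirtinger_base0 b q).
move=> /wirtinger_dzb ->; rewrite addr0 rhoN rho1 // fmorphV /= normsqE invfM.
by rewrite [fiber q * _]mulrA mulfV // mul1r.
Qed.

Lemma loghomog_dzbS_near p (j : 'I_d) : punctured U p ->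
  {near p, (fun q => dzb j b (base q)) =1 dzb (rs j) f}.
Proof.
move=> Wp; apply: (@filterS _ _ _ (punctured U)); last first.
  exact: open_nbhs_nbhs (conj (open_punctured oU) Wp).
move=> q [Uq z0] /=; rewrite -[in RHS](mkpt_fiber_base q) dzb_slice.
have bq : {near base q, (fun w => k%:C * (ln (normsq (fiber q)))%:C + b w) =1
    (fun w => f (mkpt (fiber q) w))}.
  apply: (@filterS _ _ _ U); last exact: open_nbhs_nbhs (conj oU Uq).
  by move=> w Uw /=; rewrite fE.
by rewrite -(dzb_near _ bq) /dzb !cderive_addr.
Qed.

(** Away from z = 0, log |z|^2 is pluriharmonic, and the fibre derivatives of b(w) vanish. Applied
    to log det omega0, this makes V^(1,0) contract to zero with the Ricci form. *)
Lemma loghomog_ddb_row0 p j : punctured U p -> ddb f p l0 j = 0.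
Proof.
move=> Wp; rewrite mxE; have [Up z0] := Wp.
case: (split_ordP j) => j' ->; rewrite ?ord1.
- rewrite -(dz_near _ (loghomog_dzb0_near Wp)).
  have := wirtingerZ k%:C (wirtingerM (wirtinger_fiber0 p) (wirtinger_rho0 (-1) z0)).
  by move=> /wirtinger_dz ->; rewrite rmorphN rmorph1 mulN1r; field.
- rewrite -(dz_near _ (loghomog_dzbS_near j' Wp)).
  exact: wirtinger_dz (wirtinger_base0 _ p).
Qed.

Lemma loghomog_ddb_col0 p i : punctured U p -> ddb f p i l0 = 0.
Proof.
move=> Wp; case: (split_ordP i) => i' ->; rewrite ?ord1 ?loghomog_ddb_row0 //.
rewrite mxE -(dz_near _ (loghomog_dzb0_near Wp)); have [Up z0] := Wp.
have := wirtingerZ k%:C (wirtingerM (wirtinger_fiberS p i') (wirtinger_rhoS (-1) i' z0)).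
by move=> /wirtinger_dz ->; rewrite mul0r mulr0 addr0 mulr0.
Qed.

Lemma loghomog_ddb_base z w (i j : 'I_d) : U w -> z != 0 ->
  ddb f (mkpt z w) (rs i) (rs j) = dz i (dzb j b) w.
Proof.
move=> Uw z0; rewrite mxE dz_slice; apply: dz_near.
apply: (@filterS _ _ _ U); last exact: open_nbhs_nbhs (conj oU Uw).
move=> w' Uw' /=.
have W' : punctured U (mkpt z w') by rewrite /punctured /= base_mkpt fiber_mkpt.
by rewrite -(nbhs_singleton (loghomog_dzbS_near j W')) base_mkpt.
Qed.

Lemma loghomog_ddb z w : U w -> z != 0 ->
  ddb f (mkpt z w) = coframe z *m ddb f (mkpt 1 w) *m coframe_conj z.
Proof.
move=> Uw z0; have n1 : 1 != 0 :> R[i] by exact: oner_neq0.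
have Wz : punctured U (mkpt z w) by rewrite /punctured /= base_mkpt fiber_mkpt.
have W1 : punctured U (mkpt 1 w) by rewrite /punctured /= base_mkpt fiber_mkpt.
apply/matrixP => i j; rewrite coframe_mulE.
case: (split_ordP i) => i' ->; case: (split_ordP j) => j' ->; rewrite ?ord1.
- by rewrite [LHS](loghomog_ddb_row0 _ Wz) [X in _ * X * _](loghomog_ddb_row0 _ W1) mulr0 mul0r.
- by rewrite [LHS](loghomog_ddb_row0 _ Wz) [X in _ * X * _](loghomog_ddb_row0 _ W1) mulr0 mul0r.
- by rewrite [LHS](loghomog_ddb_col0 _ Wz) [X in _ * X * _](loghomog_ddb_col0 _ W1) mulr0 mul0r.
- rewrite [LHS](loghomog_ddb_base _ _ Uw z0).
  rewrite [X in _ * X * _](loghomog_ddb_base _ _ Uw n1).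
  by rewrite !fiber_coefS conjc1 mul1r mulr1.
Qed.

End LogHomogeneous.
End HomogeneousFunctions.

(** * Positive definite complex matrices have positive determinant *)

Section PositiveDeterminant.
Context {R : rcfType}.

(** Induction by block elimination: the determinant is the corner entry [a] times that of the Schur
    complement [S], which is again positive definite. *)
Lemma posdef_det_gt0 n (g : 'M[R[i]]_n) :
  (forall v : 'rV[R[i]]_n, v != 0 -> 0 < (v *m g *m (map_mx conjc v)^T) 0 0) ->
  0 < \det g.
Proof.
elim: n g => [|n IH] g gpos; first by rewrite det_mx00 ltr01.
pose h : 'M[R[i]]_(1 + n) := g.
have hpos (v : 'rV[R[i]]_(1 + n)) : v != 0 -> 0 < (v *m h *m (map_mx conjc v)^T) 0 0.
  exact: gpos.
pose a := ulsubmx h 0 0.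
have Ea : ulsubmx h = a%:M by apply/matrixP => i j; rewrite !ord1 [RHS]mxE eqxx mulr1n.
have a0 : 0 < a.
  have /hpos : row_mx 1%:M 0 != 0 :> 'rV[R[i]]_(1 + n).
    apply: contra_neq (@oner_neq0 R[i]) => /matrixP/(_ 0 (lshift n 0)).
    by rewrite row_mxEl !mxE eqxx mulr1n.
  rewrite -[in X in X -> _](submxK h) mul_row_block map_row_mx map_mx1 map_mx0.
  by rewrite tr_row_mx trmx1 trmx0 mul_row_col !mul1mx !mul0mx mulmx0 !addr0 mulmx1.
have an0 : a != 0 by rewrite gt_eqF.
pose S := drsubmx h - a^-1 *: (dlsubmx h *m ursubmx h).
have hE : h = block_mx 1%:M 0 (a^-1 *: dlsubmx h) 1%:M *m block_mx a%:M (ursubmx h) 0 S.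
  rewrite mulmx_block !mul1mx !mul0mx !addr0.
  rewrite mul_mx_scalar scalerA mulfV // scale1r.
  rewrite -scalemxAl /S addrC subrK -Ea.
  by rewrite submxK.
have -> : \det g = a * \det S.
  change (@determinant _ (1 + n) h = a * \det S).
  by rewrite [in LHS]hE det_mulmx det_lblock det_ublock !det1 !mul1r det_scalar1.
rewrite mulr_gt0 //.
(* The first coordinate [x] is chosen so that [row_mx x v *m h] has first entry 0; its remaining
   part is then [v *m S]. *)
apply: IH => v v0; pose x : 'M[R[i]]_1 := - a^-1 *: (v *m dlsubmx h).
have /hpos : row_mx x v != 0 :> 'rV[R[i]]_(1 + n).
  apply: contra_neq v0 => /(congr1 rsubmx); by rewrite row_mxKr raddf0.
rewrite -[in X in X -> _](submxK h) mul_row_block Ea mul_mx_scalar /x scalerA mulrN mulfV //.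
rewrite scaleN1r addNr map_row_mx tr_row_mx mul_row_col mul0mx add0r.
by rewrite /S mulmxBr -scalemxAr scaleNr mulNmx -scalemxAl mulmxA addrC.
Qed.

End PositiveDeterminant.

(** * Trace of the logarithm under conjugation and rescaling by weight *)

Section TrlogConjugation.
Context {K : fieldType} {n : nat}.
Variables (A B : nat -> 'M[K]_n) (P : 'M[K]_n) (r : nat -> K) (N : nat).
Hypotheses (Pu : P \in unitmx) (r0 : r 0%N = 1) (rD : forall i j, r (i + j)%N = r i * r j).
Hypothesis BA : forall i, (i <= N)%N -> B i = r i *: (P *m A i *m invmx P).

(** In each product of total weight k the scalars multiply to [r k] and the inner factors of [P]
    cancel. No component above weight k occurs, so a bound [N] on the range of [BA] is enough, as
    the induction on weights requires. *)
Lemma series_pow_conjugate m k : (k <= N)%N ->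
  series_pow B m k = r k *: (P *m series_pow A m k *m invmx P).
Proof.
elim: m k => [|m IH] k kN /=.
  case: eqP => [->|_]; last by rewrite mulmx0 mul0mx scaler0.
  by rewrite r0 scale1r mulmx1 mulmxV.
rewrite mulmx_sumr mulmx_suml scaler_sumr; apply: eq_bigr => i _.
have ik : (i <= k)%N by rewrite -ltnS.
rewrite IH ?(leq_trans (leq_subr _ _)) // BA ?(leq_trans ik) //.
rewrite -scalemxAl -scalemxAr scalerA -rD subnK //; congr (_ *: _).
by rewrite !mulmxA mulmxKV.
Qed.

Lemma trlog_conjugate k : (k <= N)%N -> trlog B k = r k * trlog A k.
Proof.
move=> kN; rewrite /trlog mulr_sumr; apply: eq_bigr => m _.
rewrite series_pow_conjugate // mxtraceZ mxtrace_mulC mulmxA mulVmx // mul1mx.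
by rewrite mulrCA.
Qed.

End TrlogConjugation.

(** * The metric, omega0, its Ricci form and the perturbation in a trivialization *)

Section BundleMetric.
Context {R : realType} {d : nat} {D : compactComplexManifold R d} (E : lineBundle D).
Implicit Types (a : triv_index E) (z : R[i]) (w : Cn R d).
Local Notation l0 := (lshift d 0).
Local Notation rs := (rshift 1).
Local Notation dom a := (cimg (tchart a)).

Lemma img'P a p : img' a p <-> punctured (dom a) p.
Proof. by split=> -[/triv_img ? ?]. Qed.

Lemma img'_mkpt a z w : dom a w -> z != 0 -> img' a (mkpt z w).
Proof. by move=> Uw z0; apply/img'P; rewrite /punctured /= base_mkpt fiber_mkpt. Qed.

Lemma open_dom a : open (dom a). Proof. exact: open_cimg. Qed.

Lemma img'_ind a (P : Cn R (1 + d) -> Prop) :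
  (forall z w, dom a w -> z != 0 -> P (mkpt z w)) -> forall p, img' a p -> P p.
Proof. by move=> H p /img'P[Uw z0]; rewrite -(mkpt_fiber_base p); exact: H. Qed.

Lemma csmooth_section a (f : Cn R (1 + d) -> R[i]) :
  csmooth_on (img' a) f -> csmooth_on (dom a) (fun w => f (mkpt 1 w)).
Proof.
move=> [fr fi]; have sub : dom a `<=` mkpt 1 @^-1` img' a.
  by move=> w Uw; apply: img'_mkpt => //; exact: oner_neq0.
split; apply: (smooth_on_sub sub).
- exact: (smooth_on_affine (mkpt_base_linear 1) (differentiable_mkpt_base 1) fr).
- exact: (smooth_on_affine (mkpt_base_linear 1) (differentiable_mkpt_base 1) fi).
Qed.

Section Metric.
Variable N : E -> R.
Hypothesis hN : hermitian_metric N.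

Lemma metricE a z w : dom a w ->
  N (cpoint (triv a) (mkpt z w)) = local_weight N a w * normsq z.
Proof.
move=> Uw; have [_ _ /(_ (mkpt z w))] := hN a.
rewrite triv_img base_mkpt fiber_mkpt -normsqE -rmorphM => /(_ Uw) /(congr1 (@complex.Re R)).
by [].
Qed.

Lemma weight_gt0 a w : dom a w -> 0 < local_weight N a w.
Proof. by move=> Uw; have [_ + _] := hN a; apply. Qed.

Lemma smooth_weight a : smooth_on (dom a) (local_weight N a).
Proof. by have [] := hN a. Qed.

Lemma metricV_homog a z w : dom a w -> z != 0 ->
  local_fun (fun e => (N e)^-1) a (mkpt z w) =
  (rho (-1) z)%:C * ((local_weight N a w)^-1)%:C.
Proof.
move=> Uw z0; rewrite /local_fun metricE // rhoN rho1 // -rmorphM invfM mulrC.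
by [].
Qed.

Lemma csmooth_weightV a : csmooth_on (dom a) (fun w => ((local_weight N a w)^-1)%:C).
Proof.
apply: csmooth_real; apply: smooth_onV; [exact: open_dom| |exact: smooth_weight].
by move=> w Uw; rewrite gt_eqF // weight_gt0.
Qed.

Lemma csmooth_lnweight a : csmooth_on (dom a) (fun w => (ln (local_weight N a w))%:C).
Proof.
apply: csmooth_real; apply: smooth_on_ln; [exact: open_dom| |exact: smooth_weight].
exact: weight_gt0.
Qed.

Lemma omega0_scale a z w : dom a w -> z != 0 ->
  omega0 N a (mkpt z w) =
  (rho (-1) z)%:C *: (coframe z *m omega0 N a (mkpt 1 w) *m coframe_conj z).
Proof.
exact: (homog_ddb (@open_dom a) (@metricV_homog a) (csmooth_weightV a)).
Qed.

Lemma is_derive_inv (x : R) : x != 0 -> is_derive x 1 (fun y => y^-1) (- x ^- 2).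
Proof.
move=> x0; apply: is_derive_eq (is_deriveV (f := id) x0 (is_derive_id x 1)) _.
by rewrite /GRing.scale /= mulr1.
Qed.

Lemma wirtinger_weightV a w (j : 'I_d) : dom a w ->
  let H := ((local_weight N a w)^-1)%:C in
  let L := fun w => (ln (local_weight N a w))%:C in
  wirtinger j (fun w => ((local_weight N a w)^-1)%:C) w
    (- (H * dz j L w)) (- (H * dzb j L w)).
Proof.
move=> Uw H L; have h0 := weight_gt0 Uw.
have hn0 : local_weight N a w != 0 by rewrite gt_eqF.
have wh := csmooth_wirtinger j (csmooth_real (@smooth_weight a)) Uw.
have [-> ->] := wirtinger_val (wirtinger_real_comp wh (is_derive1_ln h0)).
apply: wirtinger_eq (wirtinger_real_comp wh (is_derive_inv hn0)) _ _;
  by rewrite /H mulrA -mulNr rmorphN fmorphV rmorphXn fmorphV expr2 invfM.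
Qed.

(** This is the second derivative of H = exp(-L); the term with the mixed derivative of L is the
    curvature. *)
Lemma ddb_weightV a w (i j : 'I_d) : dom a w ->
  let H := ((local_weight N a w)^-1)%:C in
  let L := fun w => (ln (local_weight N a w))%:C in
  dz i (dzb j (fun w => ((local_weight N a w)^-1)%:C)) w =
  H * (dz i L w * dzb j L w - dz i (dzb j L) w).
Proof.
move=> Uw H L.
have Hn : {near w, (fun w => -1 * (((local_weight N a w)^-1)%:C * dzb j L w)) =1
    dzb j (fun w => ((local_weight N a w)^-1)%:C)}.
  apply: (@filterS _ _ _ (dom a)); last exact: open_nbhs_nbhs (conj (@open_dom a) Uw).
  by move=> w' Uw' /=; rewrite (wirtinger_dzb (wirtinger_weightV j Uw')) mulN1r.
rewrite -(dz_near _ Hn).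
have wL := csmooth_wirtinger i (csmooth_dzb (@open_dom a) j (csmooth_lnweight a)) Uw.
have := wirtingerZ (-1) (wirtingerM (wirtinger_weightV i Uw) wL).
by move=> /wirtinger_dz ->; rewrite -/L -/H; ring.
Qed.

(** With theta = dz/z + dL (d the (1,0) derivative), omega0 is H times the sum of sqrt(-1) theta /\
    conj theta and the curvature. Completing this square gives triangular factors, so the
    determinant is H^(1+d) times that of the curvature. *)
Lemma omega0_factor a w : dom a w ->
  let H := ((local_weight N a w)^-1)%:C in
  let L := fun w => (ln (local_weight N a w))%:C in
  omega0 N a (mkpt 1 w) = H *:
    (block_mx 1%:M 0 (\col_i dz i L w) 1%:M *m
     block_mx 1%:M (\row_j dzb j L w) 0 (curvature N a w)).
Proof.
move=> Uw H L; have W1 : punctured (dom a) (mkpt 1 w).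
  by rewrite /punctured /= base_mkpt fiber_mkpt; split => //; exact: oner_neq0.
rewrite mulmx_block !mul1mx !mul0mx !mulmx1 !addr0.
apply/matrixP => i j; rewrite [RHS]mxE.
case: (split_ordP i) => i' ->; case: (split_ordP j) => j' ->; rewrite ?ord1.
- rewrite block_mxEul [X in _ = _ * X]mxE eqxx mulr1n mulr1.
  rewrite [LHS](homog_ddb00 (@open_dom a) (@metricV_homog a) W1).
  by rewrite base_mkpt fiber_mkpt rho_of1 conjc1 rmorphN1 sqrrN expr1n !mulr1 invr1 !mul1r.
- rewrite block_mxEur [X in _ = _ * X]mxE.
  rewrite [LHS](homog_ddb0S (@open_dom a) (@metricV_homog a) (csmooth_weightV a) j' W1).
  rewrite base_mkpt fiber_mkpt rho_of1 (wirtinger_dzb (wirtinger_weightV j' Uw)).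
  by rewrite rmorphN1 mulr1 invr1 mulr1 mulN1r opprK.
- rewrite block_mxEdl [X in _ = _ * X]mxE.
  rewrite [LHS](homog_ddbS0 (@open_dom a) (@metricV_homog a) (csmooth_weightV a) i' W1).
  rewrite base_mkpt fiber_mkpt rho_of1 conjc1 (wirtinger_dz (wirtinger_weightV i' Uw)).
  by rewrite rmorphN1 mulr1 invr1 mulr1 mulN1r opprK.
- rewrite block_mxEdr.
  rewrite [LHS](homog_ddbSS (@open_dom a) (@metricV_homog a) (csmooth_weightV a) i' j' W1).
  rewrite base_mkpt fiber_mkpt rho_of1 mul1r [LHS]mxE ddb_weightV //; congr (_ * _).
  rewrite [RHS]mxE mxE big_ord1 !mxE.
  by rewrite /curvature.
Qed.

Lemma ln_Re_realM (r : R) (x y : R[i]) : 0 < r -> 0 < x -> y = r%:C * x ->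
  (ln (complex.Re y))%:C = (ln r)%:C + (ln (complex.Re x))%:C.
Proof.
move=> r0; rewrite ltcE => /andP[_ x0] ->.
by rewrite cRe_realM lnM ?posrE // rmorphD.
Qed.

Lemma invmx_mul n (A B : 'M[R[i]]_n) : A \in unitmx -> B \in unitmx ->
  invmx (A *m B) = invmx B *m invmx A.
Proof.
move=> uA uB; have uAB : A *m B \in unitmx by rewrite unitmx_mul uA.
by apply: (can_inj (mulKmx uAB)); rewrite mulmxV // mulmxA mulmxK // mulmxV.
Qed.

(** When Z and Y are transformed by the same congruence, [invmx Z *m Y] is only conjugated: the left
    coframe [C] cancels. The double inverse matches the shape expected by [trlog_conjugate]. *)
Lemma invmx_congruence n (r s : R[i]) (Z M C C' X Y : 'M[R[i]]_n) :
  C \in unitmx -> invmx Z = r *: (invmx C' *m invmx M *m invmx C) ->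
  Y = s *: (C *m X *m C') ->
  invmx Z *m Y = (r * s) *: (invmx C' *m (invmx M *m X) *m invmx (invmx C')).
Proof.
move=> uC -> ->.
by rewrite invmxK -scalemxAr -scalemxAl scalerA [s * r]mulrC !mulmxA mulmxKV.
Qed.

Section Kahler.
Hypothesis hK : forall a, kahler_on (dom a) (curvature N a).

Lemma det_omega0_gt0 a w : dom a w -> 0 < \det (omega0 N a (mkpt 1 w)).
Proof.
move=> Uw; rewrite omega0_factor // detZ det_mulmx det_lblock det_ublock !det1 !mul1r.
apply: mulr_gt0; last by apply: posdef_det_gt0; have [_ + _ _] := hK a; apply.
by apply: exprn_gt0; rewrite ltcR invr_gt0 weight_gt0.
Qed.

(** The scalar |z|^(-2) enters to the power 1 + d, and the two changes of coframe together
    contribute one more |z|^(-2). *)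
Lemma det_omega0 a z w : dom a w -> z != 0 ->
  \det (omega0 N a (mkpt z w)) =
  (rho (- d.+2%:R) z)%:C * \det (omega0 N a (mkpt 1 w)).
Proof.
move=> Uw z0; rewrite omega0_scale // detZ !det_mulmx det_coframe det_coframe_conj.
rewrite mulrAC -invfM -normsqE -rho1 // -fmorphV -rhoN mulrA -rmorphXn -rmorphM.
have -> : - d.+2%:R = (1 + d)%:R * -1 + -1 :> R by rewrite mulrN1 -opprD natr1.
by rewrite rhoXn -rhoD.
Qed.

Lemma ln_det_omega0 a z w : dom a w -> z != 0 ->
  (ln (complex.Re (\det (omega0 N a (mkpt z w)))))%:C =
  (- d.+2%:R)%:C * (ln (normsq z))%:C +
  (ln (complex.Re (\det (omega0 N a (mkpt 1 w)))))%:C.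
Proof.
move=> Uw z0; apply: etrans (ln_Re_realM (rho_gt0 _ _) (det_omega0_gt0 Uw) (det_omega0 Uw z0)) _.
by rewrite -rmorphM /rho expRK.
Qed.

Lemma omega0_unit a z w : dom a w -> z != 0 -> omega0 N a (mkpt z w) \in unitmx.
Proof.
move=> Uw z0; rewrite unitmxE unitfE det_omega0 // mulf_neq0 ?rhoC_neq0 //.
by rewrite gt_eqF // det_omega0_gt0.
Qed.

Lemma ricci_omega0_scale a z w : dom a w -> z != 0 ->
  ricci (omega0 N a) (mkpt z w) =
  coframe z *m ricci (omega0 N a) (mkpt 1 w) *m coframe_conj z.
Proof.
move=> Uw z0; rewrite /ricci (loghomog_ddb (@open_dom a) (@ln_det_omega0 a) Uw z0).
by rewrite mulmxN mulNmx.
Qed.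

Lemma iprod_ricci_omega0 a p j : img' a p ->
  iprod (@Vhol R d) (fun q => - ricci (omega0 N a) q) p j = 0.
Proof.
move=> /img'P Wp.
rewrite /iprod sum_Vhol /ricci opprK.
by rewrite (loghomog_ddb_row0 (@open_dom a) (@ln_det_omega0 a) _ Wp) !mulr0.
Qed.

(** Weight 2l and circle invariance at once, since [rho l z] depends on |z| only. *)
Definition homogeneous (l : R) (f : E -> R) : Prop := forall a z w,
  dom a w -> z != 0 ->
  local_fun f a (mkpt z w) = (rho l z)%:C * local_fun f a (mkpt 1 w).

(** Inverting omega0 produces a factor |z|^2, so component i contains [u (i - 2)]. For i up to k
    this calls only on [u j] with j < k, which is what makes an induction on k possible; the
    coframes survive as a conjugation, invisible to the trace. *)
Lemma perturbation_scale (u : nat -> E -> R) a z w k :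
  (forall j, (0 < j)%N -> smooth' (u j)) ->
  (forall j, (0 < j < k)%N -> homogeneous (j%:R / 2) (u j)) -> dom a w -> z != 0 ->
  forall i, (i <= k)%N -> perturbation N u a (mkpt z w) i =
   (rho (i%:R / 2) z)%:C *: (invmx (coframe_conj z) *m perturbation N u a (mkpt 1 w) i
      *m invmx (invmx (coframe_conj z))).
Proof.
move=> su hu Uw z0 i ik; have n1 := @oner_neq0 R[i].
have C1 := coframe_unit (d := d) z0; have C2 := coframe_conj_unit (d := d) z0.
have M1 := omega0_unit Uw n1.
have invE : invmx (omega0 N a (mkpt z w)) =
    (rho 1 z)%:C *: (invmx (coframe_conj z) *m invmx (omega0 N a (mkpt 1 w)) *m invmx (coframe z)).
  have := omega0_unit Uw z0; rewrite omega0_scale // => u1.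
  rewrite invmxZ // !invmx_mul ?unitmx_mul ?C1 ?C2 ?M1 // !mulmxA.
  by rewrite rhoN fmorphV invrK.
rewrite /perturbation; case: eqP => [i2|_].
  have Er := ricci_omega0_scale Uw z0; rewrite -[RHS]scale1r in Er.
  apply: etrans (congr1 -%R (invmx_congruence C1 invE Er)) _.
  have opp (r : R[i]) (A X B : 'M[R[i]]_(1 + d)) :
      - (r *: (A *m X *m B)) = r *: (A *m (- X) *m B).
    by rewrite mulmxN mulNmx scalerN.
  by apply: etrans (opp _ _ _ _) _; rewrite mulr1 i2 divff ?pnatr_eq0.
case i2 : (2 < i)%N; last by rewrite mulmx0 mul0mx scaler0.
have ri : (0 < i - 2 < k)%N.
  rewrite subn_gt0 i2 /= (leq_trans _ ik) // ltn_subrL /=.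
  exact: leq_trans i2.
have /andP[ri0 _] := ri.
have Eu := homog_ddb (@open_dom a) (hu _ ri a) (csmooth_section (su _ ri0 a)) Uw z0.
apply: etrans (invmx_congruence C1 invE Eu) _; congr (_ *: _).
(* The summand 1 comes from the inverse of omega0, the other from [u (i - 2)]. *)
have -> : i%:R / 2 = 1 + (i - 2)%:R / 2 :> R.
  by rewrite natrB ?(ltnW i2) //; field.
by rewrite rhoD rmorphM.
Qed.

Lemma trlog_perturbation_scale (u : nat -> E -> R) a z w k :
  (forall j, (0 < j)%N -> smooth' (u j)) ->
  (forall j, (0 < j < k)%N -> homogeneous (j%:R / 2) (u j)) -> dom a w -> z != 0 ->
  trlog (perturbation N u a (mkpt z w)) k =
  (rho (k%:R / 2) z)%:C * trlog (perturbation N u a (mkpt 1 w)) k.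
Proof.
move=> su hu Uw z0.
apply: (trlog_conjugate (P := invmx (coframe_conj z)) (r := fun i => (rho (i%:R / 2) z)%:C)
  (N := k)) => //.
- by rewrite unitmx_inv coframe_conj_unit.
- by rewrite mul0r rho0.
- by move=> i j; rewrite natrD mulrDl rhoD rmorphM.
- exact: perturbation_scale.
Qed.

End Kahler.
End Metric.
End BundleMetric.

(** * One-variable second derivative tests *)

Section SecondDerivativeTest.
Context {R : realType}.

(** Fermat's rule gives the first claim. If [c] were negative, [dq] would be negative just to the
    right of 0, and the mean value theorem would make [q] negative there. *)
Lemma second_derivative_test (q dq : R -> R) (c : R) :
  (\forall t \near (0 : R), is_derive (t : R) 1 q (dq t)) ->
  is_derive (0 : R) 1 dq c -> q 0 = 0 -> (\forall t \near (0 : R), 0 <= q t) ->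
  dq 0 = 0 /\ 0 <= c.
Proof.
move=> dqE ddq q0 qge0.
have /nbhs_ballP[e /= e0 He] : nbhs (0 : R) [set t : R | is_derive t 1 q (dq t) /\ 0 <= q t].
  by apply: filterS2 dqE qge0 => t.
have inB t : t \in `]-e, e[%R -> is_derive t 1 q (dq t) /\ 0 <= q t.
  rewrite in_itv /= => te; apply: He; rewrite /ball /= sub0r normrN.
  by rewrite ltr_norml.
have in0 : 0 \in `]-e, e[%R by rewrite in_itv /= oppr_lt0 e0.
have dq0 : dq 0 = 0.
  have [_ <-] := (inB _ in0).1.
  have ee : -e <= e by rewrite ltW // (lt_trans _ e0) // oppr_lt0.
  have [] // := @derive1_at_min R q (-e) e 0 ee _ in0.
  - by move=> t /inB[[]].
  - by move=> t /inB[_ ?]; rewrite q0.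
split=> //; rewrite leNgt; apply/negP => c0.
(* Caratheodory's slope function: [dq x] is [g x * x] with [g] continuous at 0 and [g 0 = c], so the
   sign of [c] persists near 0. *)
have [g [gE gc g0]] := (is_derive1_caratheodory dq 0 c).1 ddq.
have /nbhs_ballP[e' /= e'0 He'] : nbhs (0 : R) [set t : R | g t < 0].
  by apply: (cvgr_lt (g 0) gc); rewrite g0.
pose t := Num.min e e' / 2.
have m0 : 0 < Num.min e e' by rewrite lt_min e0.
have t0 : 0 < t by rewrite divr_gt0.
have tm : t < Num.min e e' by rewrite ltr_pdivrMr // ltr_pMr // ltr1n.
have [te te'] : t < e /\ t < e' by move: tm; rewrite lt_min => /andP.
have ine x : x \in `[0, t]%R -> x \in `]-e, e[%R.
  rewrite !in_itv /= => /andP[x0 xt]; apply/andP; split.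
    by rewrite (lt_le_trans _ x0) // oppr_lt0.
  exact: le_lt_trans te.
have [x xt] : exists2 x, x \in `]0, t[%R & q t - q 0 = dq x * (t - 0).
  apply: (@MVT R q dq) => //.
  - by move=> x xt; apply: (inB _ _).1; apply: ine; exact: subset_itv_oo_cc.
  - apply: derivable_within_continuous => x xt.
    by have [[]] := inB _ (ine _ xt).
rewrite q0 !subr0 => qt.
have /inB[_] : t \in `]-e, e[%R by apply: ine; rewrite in_itv /= lexx ltW.
rewrite qt leNgt => /negP; apply.
move: xt; rewrite in_itv /= => /andP[x0 xt].
rewrite nmulr_rlt0 //; have := gE x; rewrite dq0 !subr0 => ->.
rewrite nmulr_rlt0 //; apply: He'; rewrite /ball /= sub0r normrN gtr0_norm //.
exact: lt_trans te'.
Qed.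

(** The test is applied to the difference of the two sides of the last hypothesis; at first order it
    forces [dB 0 = 0]. The conclusion is linear in [cA] and [cB], so it can be added over two
    directions. *)
Lemma squared_exp_test (A B dA dB : R -> R) (cA cB : R) :
  (\forall t \near (0 : R), is_derive (t : R) 1 A (dA t)) ->
  (\forall t \near (0 : R), is_derive (t : R) 1 B (dB t)) ->
  is_derive (0 : R) 1 dA cA -> is_derive (0 : R) 1 dB cB ->
  dA 0 = 0 -> B 0 != 0 ->
  (\forall t \near (0 : R), B t ^+ 2 <= B 0 ^+ 2 * expR (A t - A 0)) ->
  2 * (B 0 * cB) <= B 0 ^+ 2 * cA.
Proof.
move=> A1 B1 A2 B2 dA0 B0 le.
pose q t := B 0 ^+ 2 * expR (A t - A 0) - B t ^+ 2.
pose dq t := B 0 ^+ 2 * (expR (A t - A 0) * dA t) - 2 * (B t * dB t).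
pose c := B 0 ^+ 2 * cA - 2 * (dB 0 ^+ 2 + B 0 * cB).
have expA (t : R) : is_derive t 1 A (dA t) ->
    is_derive t 1 (fun s => expR (A s - A 0)) (expR (A t - A 0) * dA t).
  move=> At; apply: (is_derive1_comp (f := expR)).
  by apply: is_derive_eq (is_deriveB At (is_derive_cst (A 0) t 1)) _; rewrite subr0.
have A10 := nbhs_singleton A1; have B10 := nbhs_singleton B1.
have [| | | |dq0 c0] := @second_derivative_test q dq c.
- apply: filterS2 A1 B1 => t At Bt.
  apply: is_derive_eq (is_deriveB (is_deriveZ (B 0 ^+ 2) (expA t At)) (is_deriveX 2 Bt)) _.
  by rewrite /dq /GRing.scale /= expr1; ring.
- apply: is_derive_eq (is_deriveB (is_deriveZ (B 0 ^+ 2) (is_deriveM (expA 0 A10) A2))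
    (is_deriveZ 2 (is_deriveM B10 B2))) _.
  by rewrite /c /GRing.scale /= dA0 subrr expR0; ring.
- by rewrite /q subrr expR0 mulr1 subrr.
- by apply: filterS le => t le; rewrite subr_ge0.
have dB0 : dB 0 = 0.
  move: dq0; rewrite /dq dA0 !mulr0 sub0r => /eqP.
  by rewrite oppr_eq0 !mulf_eq0 pnatr_eq0 (negPf B0) /= => /eqP.
by move: c0; rewrite /c dB0 expr0n add0r subr_ge0.
Qed.

Lemma line_derivatives (V : normedModType R) (W : set V) (f : V -> R) (p v : V) :
  open W -> smooth_on W f -> W p ->
  (\forall t \near (0 : R), is_derive (t : R) 1 (fun s => f (s *: v + p)) ('D_v f (t *: v + p))) /\
  is_derive (0 : R) 1 (fun s => 'D_v f (s *: v + p)) ('D_v ('D_v f) p).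
Proof.
move=> oW sf Wp; pose L (t : R) := t *: v + p.
have HL (t s x : R) : L (t *: s + x) = t *: (s *: v) + L x.
  by rewrite /L scalerDl scalerA addrA.
have cL : {for 0, continuous L}.
  by apply: differentiable_continuous; rewrite /L; exact: differentiableD.
have deriv (g : V -> R) (t : R) : differentiable g (L t) -> is_derive t 1 (fun s => g (L s)) ('D_v g (L t)).
  move=> dg; apply: DeriveDef.
    rewrite (@derivable_affine _ _ _ L (fun s : R => s *: v) g t 1 HL) scale1r.
    exact: diff_derivable.
  by rewrite (@derive_affine _ _ _ L (fun s : R => s *: v) g t 1 HL) scale1r.
have L0 : L 0 = p by rewrite /L scale0r add0r.
split.
- have : nbhs (0 : R) [set t : R | W (L t)].
    by apply: cL; rewrite L0; exact: open_nbhs_nbhs (conj oW Wp).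
  by apply: filterS => t WLt; apply: deriv; exact: (smooth_on_differentiable sf WLt).
- have := deriv ('D_v f) 0; rewrite L0; apply.
  by apply: (smooth_on_differentiable _ Wp); exact: smooth_on_derive.
Qed.

End SecondDerivativeTest.

Lemma conjci (R : rcfType) : conjc 'i = - 'i :> R[i].
Proof. by apply: complexP; rewrite //= oppr0. Qed.

(** * Real second derivatives in terms of the complex Hessian *)

Section ComplexHessian.
Context {R : realType} {m : nat}.
Implicit Types (c : 'I_m -> R[i]) (p : Cn R m) (f : Cn R m -> R).

(** The real tangent vector X + conj X for X = \sum_i c_i d/dz_i. *)
Definition cvec c : Cn R m := (\row_i complex.Re (c i), \row_i complex.Im (c i)).

Lemma cvecE c :
  cvec c = \sum_i (complex.Re (c i) *: ex R i + complex.Im (c i) *: ey R i).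
Proof.
have pairP (x y : Cn R m) : x.1 = y.1 -> x.2 = y.2 -> x = y.
  by case: x => a b; case: y => a' b' /= -> ->.
apply: pairP.
- rewrite [RHS](raddf_sum fst) [LHS]row_sum_delta; apply: eq_bigr => i _.
  by rewrite !mxE /= scaler0 addr0.
- rewrite [RHS](raddf_sum snd) [LHS]row_sum_delta; apply: eq_bigr => i _.
  by rewrite !mxE /= scaler0 add0r.
Qed.

Lemma derive_cvec f p c : differentiable f p -> 'D_(cvec c) f p =
  \sum_i (complex.Re (c i) * 'D_(ex R i) f p + complex.Im (c i) * 'D_(ey R i) f p).
Proof.
move=> df; rewrite deriveE // cvecE linear_sum; apply: eq_bigr => i _.
by rewrite linearD !linearZ !deriveE.
Qed.

Lemma cderive_cvec (g : Cn R m -> R[i]) p c : cdiff g p -> cderive (cvec c) g p =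
  \sum_i (c i * dz i g p + conjc (c i) * dzb i g p).
Proof.
move=> [dr di]; have dzE i : c i * dz i g p + conjc (c i) * dzb i g p =
    (complex.Re (c i))%:C * cderive (ex R i) g p +
    (complex.Im (c i))%:C * cderive (ey R i) g p.
  have cE : c i = (complex.Re (c i))%:C + 'i * (complex.Im (c i))%:C by exact: complexE.
  have ccE : conjc (c i) = (complex.Re (c i))%:C - 'i * (complex.Im (c i))%:C.
    by rewrite {1}cE rmorphD rmorphM /= !conjc_real conjci mulNr.
  rewrite [in X in X + _]cE ccE /dz /dzb.
  set x := cderive (ex R i) g p; set y := cderive (ey R i) g p.
  (* The factor 1 is written as -('i * 'i) so that [field] can match both sides with 'i as an
     atom. *)
  have -> : (complex.Im (c i))%:C * y = - ('i * 'i) * ((complex.Im (c i))%:C * y).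
    by rewrite mulii opprK mul1r.
  by field.
have combRe (r s x y x' y' : R) :
    complex.Re (r%:C * (x +i* y) + s%:C * (x' +i* y')) = r * x + s * x'.
  by rewrite cReD !cRe_realM.
have combIm (r s x y x' y' : R) :
    complex.Im (r%:C * (x +i* y) + s%:C * (x' +i* y')) = r * y + s * y'.
  by rewrite cImD !cIm_realM.
rewrite (eq_bigr _ (fun i _ => dzE i)).
rewrite /cderive !derive_cvec //; apply: complexP.
- rewrite [RHS](big_morph _ (@cReD R) (erefl : complex.Re 0 = 0 :> R)); apply: eq_bigr => i _.
  exact/esym/combRe.
- rewrite [RHS](big_morph _ (@cImD R) (erefl : complex.Im 0 = 0 :> R)); apply: eq_bigr => i _.
  exact/esym/combIm.
Qed.

Lemma wirtinger_sum n (F : 'I_n -> Cn R m -> R[i]) j p (a b : 'I_n -> R[i]) :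
  (forall i, wirtinger j (F i) p (a i) (b i)) ->
  wirtinger j (fun q => \sum_i F i q) p (\sum_i a i) (\sum_i b i).
Proof.
elim: n F a b => [|n IH] F a b H.
  rewrite !big_ord0; under eq_fun do rewrite big_ord0; exact: wirtinger_cst.
rewrite !big_ord_recr; under eq_fun do rewrite big_ord_recr.
by apply: wirtingerD => //; apply: IH => i; exact: H.
Qed.

Lemma cderive_real f p v : cderive v (fun q => (f q)%:C) p = ('D_v f p)%:C.
Proof. by rewrite /cderive; congr (_ +i* _); exact: derive_cst. Qed.

Lemma dzb_real_conj f p j :
  dzb j (fun q => (f q)%:C) p = conjc (dz j (fun q => (f q)%:C) p).
Proof.
rewrite /dz /dzb !cderive_real rmorphM rmorphB rmorphM fmorphV /=.
by rewrite !conjc_real conjc_nat conjci mulNr opprK.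
Qed.

Section Laplacian.
Variables (W : set (Cn R m)) (oW : open W) (f : Cn R m -> R).
Hypothesis sf : smooth_on W f.
Local Notation fC := (fun q => (f q)%:C).

Lemma csmooth_sum n (F : 'I_n -> Cn R m -> R[i]) :
  (forall i, csmooth_on W (F i)) -> csmooth_on W (fun q => \sum_i F i q).
Proof.
elim: n F => [|n IH] F sF.
  by under eq_fun do rewrite big_ord0; exact: csmooth_cst.
under eq_fun do rewrite big_ord_recr; apply: csmoothD => //.
by apply: IH.
Qed.

(** The dbar half of the derivative of [f] along [cvec c]. As [f] is real, that derivative is 2 Re
    G, so second derivatives of [f] become first derivatives of [G]. *)
Let G c q := \sum_j conjc (c j) * dzb j fC q.

Let sG c : csmooth_on W (G c).
Proof.
apply: csmooth_sum => j; apply: csmoothZ => //; apply: csmooth_dzb => //.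
exact: csmooth_real.
Qed.

Lemma derive_cvec_real c p : W p ->
  'D_(cvec c) f p = 2 * complex.Re (\sum_j c j * dz j fC p).
Proof.
move=> Wp; have := cderive_cvec c (csmooth_cdiff (csmooth_real sf) Wp).
move=> /(congr1 (@complex.Re R)) /= ->; rewrite big_split cReD mulr_natl mulr2n.
congr (_ + _); rewrite -[RHS]Re_conjc rmorph_sum; congr complex.Re.
by apply: eq_bigr => j _; rewrite rmorphM /= -dzb_real_conj.
Qed.

Let derive_cvecG c p : W p -> 'D_(cvec c) f p = 2 * complex.Re (G c p).
Proof.
move=> Wp; rewrite derive_cvec_real // -Re_conjc rmorph_sum; congr (_ * complex.Re _).
by apply: eq_bigr => j _; rewrite rmorphM /= -dzb_real_conj.
Qed.

Let derive_Re (g : Cn R m -> R[i]) (k : R) p v : cdiff g p ->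
  'D_v (fun q => k * complex.Re (g q)) p = k * complex.Re (cderive v g p).
Proof.
move=> [dr _].
by have [_ ->] := is_deriveZ k (derivableP (diff_derivable (v := v) dr)).
Qed.

(** Replacing c by 'i c changes the sign of the (2,0) and (0,2) parts of the second derivative and
    preserves the (1,1) part, so the sum retains only the complex Hessian. *)
Lemma laplacian_cvec c p : W p ->
  'D_(cvec c) ('D_(cvec c) f) p +
  'D_(cvec (fun i => 'i * c i)) ('D_(cvec (fun i => 'i * c i)) f) p =
  4 * complex.Re (\sum_i \sum_j c i * conjc (c j) * ddb fC p i j).
Proof.
move=> Wp; have near_eq v g h : (forall q, W q -> g q = h q) ->
    'D_v g p = 'D_v h p :> R.
  by move=> gh; apply: near_eq_derive; exact: open_eq_near gh.
have Gi q : G (fun i => 'i * c i) q = - 'i * G c q.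
  rewrite /G mulr_sumr; apply: eq_bigr => j _; by rewrite rmorphM /= conjci -mulrA.
rewrite (near_eq _ _ _ (fun q => @derive_cvecG c q)).
rewrite (near_eq _ _ _ (fun q => @derive_cvecG (fun i => 'i * c i) q)).
have dG c' := csmooth_cdiff (sG c') Wp.
rewrite !derive_Re //.
have dzG i : dz i (G c) p = \sum_j conjc (c j) * ddb fC p i j.
  apply: (@wirtinger_dz _ _ _ _ _ _ (\sum_j conjc (c j) * dzb i (dzb j fC) p)).
  apply: wirtinger_sum => j; apply: wirtingerZ; rewrite /ddb mxE.
  apply: csmooth_wirtinger Wp; apply: csmooth_dzb => //; exact: csmooth_real.
have -> : cderive (cvec (fun i => 'i * c i)) (G (fun i => 'i * c i)) p =
    \sum_i (c i * dz i (G c) p - conjc (c i) * dzb i (G c) p).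
  rewrite cderive_cvec //; apply: eq_bigr => i _.
  have Gi' : G (fun i => 'i * c i) = (fun q => - 'i * G c q) by apply/funext.
  have w1 := wirtingerZ (- 'i) (csmooth_wirtinger i (sG c) Wp).
  rewrite Gi' (wirtinger_dz w1) (wirtinger_dzb w1) rmorphM /= conjci.
  set x := c i; set y := conjc x; set s := dz i (G c) p; set t := dzb i (G c) p.
  have -> : 'i * x * (- 'i * s) + - 'i * y * (- 'i * t) =
      - ('i * 'i) * (x * s) + ('i * 'i) * (y * t) by ring.
  by rewrite mulii opprK mul1r mulN1r.
rewrite cderive_cvec // -mulrDr -cReD -big_split /=.
have -> : \sum_i \sum_j c i * conjc (c j) * ddb fC p i j = \sum_i c i * dz i (G c) p.
  apply: eq_bigr => i _; rewrite dzG mulr_sumr.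
  by apply: eq_bigr => j _; rewrite mulrA.
rewrite (eq_bigr (fun i => 2 * (c i * dz i (G c) p))) => [|i _]; last by ring.
rewrite -mulr_sumr; have -> : 2 = (2 : R)%:C :> R[i] by rewrite rmorph_nat.
rewrite cRe_realM mulrA.
by congr (_ * _); ring.
Qed.

End Laplacian.
End ComplexHessian.

Section SmoothCoordinates.
Context {R : realType}.

Lemma smooth_on_linear (V : normedModType R) (U : set V) (L : V -> R) :
  (forall (t : R) (v q : V), L (t *: v + q) = t *: L v + L q) ->
  (forall q, differentiable L q) -> smooth_on U L.
Proof.
move=> HL dL s p _; elim/last_ind: s => [|s v _]; first exact: dL.
rewrite foldr_rcons (_ : 'D_v L = cst (L v)).
  exact: (@smooth_on_cst R V setT (L v) s p I).
by apply/funext => q; rewrite (derive_affine id q v HL) derive_id.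
Qed.

End SmoothCoordinates.

(** * The maximum principle in a horizontal direction *)

Section LocalMaximum.
Context {R : realType} {d : nat} {D : compactComplexManifold R d} {E : lineBundle D}.
Variable N : E -> R.
Hypothesis hN : hermitian_metric N.
Hypothesis hK : forall a : triv_index E, kahler_on (cimg (tchart a)) (curvature N a).
Implicit Types (a : triv_index E) (z : R[i]) (w : Cn R d).
Local Notation l0 := (lshift d 0).
Local Notation rs := (rshift 1).
Local Notation dom a := (cimg (tchart a)).

Lemma open_img' a : open (img' a).
Proof.
have -> : img' a = punctured (dom a) by apply/seteqP; split=> p /img'P.
exact/open_punctured/open_dom.
Qed.

(** This is log |S|^2 on E', as [ln_metric] records, written as a sum so that fibre and base
    derivatives separate. *)
Definition log_metric a (q : Cn R (1 + d)) : R :=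
  ln (local_weight N a (base q)) + ln (normsq (fiber q)).

Lemma smooth_normsq_fiber (U : set (Cn R (1 + d))) : open U ->
  smooth_on U (fun q => normsq (fiber q)).
Proof.
move=> oU; have sr : smooth_on U (fun q => complex.Re (fiber q)).
  apply: smooth_on_linear; last exact: differentiable_Re_fiber.
  by move=> t v q; rewrite fiber_linear cReD cRe_realM.
have si : smooth_on U (fun q => complex.Im (fiber q)).
  apply: smooth_on_linear; last exact: differentiable_Im_fiber.
  by move=> t v q; rewrite fiber_linear cImD cIm_realM.
by rewrite /normsq; under eq_fun do rewrite !expr2; apply: smooth_onD => //;
  exact: smooth_onM.
Qed.

Lemma smooth_base a (f : Cn R d -> R) : smooth_on (dom a) f ->
  smooth_on (img' a) (fun q => f (base q)).
Proof.
move=> sf; apply: (@smooth_on_sub _ _ (@base R d @^-1` dom a)).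
  by move=> q /img'P[].
exact: (smooth_on_affine base_linear (@differentiable_base _ _) sf).
Qed.

Lemma smooth_log_metric a : smooth_on (img' a) (log_metric a).
Proof.
have oI := @open_img' a; apply: smooth_onD => //.
  apply: (smooth_base (f := fun w => ln (local_weight N a w))).
  apply: smooth_on_ln; [exact: open_dom|exact: weight_gt0|].
  exact: smooth_weight.
apply: smooth_on_ln => //; last exact: smooth_normsq_fiber.
by move=> q [_]; rewrite normsq_gt0.
Qed.

Lemma curvature_diag_gt0 a w (j : 'I_d) : dom a w -> 0 < curvature N a w j j.
Proof.
move=> Uw; have [_ + _ _] := hK a; move=> /(_ _ Uw (delta_mx 0 j)).
have -> : delta_mx 0 j != 0 :> 'rV[R[i]]_d.
  by apply/eqP => /matrixP/(_ 0 j)/eqP; rewrite !mxE !eqxx oner_eq0.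
move=> /(_ isT); rewrite -rowE map_delta_mx trmx_delta -colE.
by rewrite !mxE.
Qed.

Local Notation lC a := (fun q => (log_metric a q)%:C).
Local Notation bC a := (fun w => (ln (local_weight N a w))%:C).

Lemma log_metricE a z w : dom a w -> z != 0 ->
  (log_metric a (mkpt z w))%:C = 1%:C * (ln (normsq z))%:C + bC a w.
Proof.
by move=> _ _; rewrite /log_metric base_mkpt fiber_mkpt rmorphD mul1r addrC.
Qed.

Lemma dz_log_metric0 a p : img' a p -> dz l0 (lC a) p = (fiber p)^-1.
Proof.
move=> [_ z0]; have := wirtingerD (wirtinger_base0 (bC a) p) (wirtinger_ln0 z0).
under eq_fun do rewrite -rmorphD.
by move=> /wirtinger_dz ->; rewrite add0r.
Qed.

Lemma dz_log_metricS a p i : img' a p -> dz (rs i) (lC a) p = dz i (bC a) (base p).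
Proof.
move=> /img'P[Up z0].
have := wirtingerD (wirtinger_baseS (csmooth_wirtinger i (csmooth_lnweight hN a) Up))
  (wirtinger_lnS i z0).
under eq_fun do rewrite -rmorphD.
by move=> /wirtinger_dz ->; rewrite addr0.
Qed.

(** The horizontal lift of d/dw_j for the Chern connection: the fibre component is the one that
    annihilates the (1,0) derivative of log |S|^2. *)
Definition horizontal a p (j : 'I_d) (i : 'I_(1 + d)) : R[i] :=
  if i == l0 then - (fiber p * dz j (bC a) (base p)) else (i == rs j)%:R.

Lemma horizontal0 a p j : horizontal a p j l0 = - (fiber p * dz j (bC a) (base p)).
Proof. by rewrite /horizontal eqxx. Qed.

Lemma horizontalS a p j i : horizontal a p j (rs i) = (i == j)%:R.
Proof. by rewrite /horizontal eq_rlshift eq_rshift. Qed.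

Lemma horizontal_dz a p j : img' a p ->
  \sum_i horizontal a p j i * dz i (lC a) p = 0.
Proof.
move=> Ip; have [_ z0] := Ip.
rewrite big_split_ord big_ord1 horizontal0 dz_log_metric0 // mulNr mulrAC mulfV // mul1r.
rewrite (bigD1 j) //= horizontalS eqxx mul1r dz_log_metricS // big1 ?addr0 ?addNr //.
by move=> i ij; rewrite horizontalS (negPf ij) mul0r.
Qed.

Lemma double_sum_base (M : 'I_(1 + d) -> 'I_(1 + d) -> R[i]) j :
  (forall i, M l0 i = 0) -> (forall i, M i l0 = 0) ->
  (forall i i', i != j -> M (rs i) i' = 0) -> (forall i i', i' != j -> M i (rs i') = 0) ->
  \sum_i \sum_i' M i i' = M (rs j) (rs j).
Proof.
move=> M1 M2 M3 M4; rewrite big_split_ord /= big_ord1 [X in X + _]big1 // add0r.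
rewrite (bigD1 j) //= [X in _ + X]big1 ?addr0 => [|i ij]; last first.
  by rewrite big1 // => i' _; exact: M3.
rewrite big_split_ord /= big_ord1 M2 add0r (bigD1 j) //= [X in _ + X]big1 ?addr0 //.
by move=> i ij; exact: M4.
Qed.

(** Since log |z|^2 is pluriharmonic, only the base block of the Hessian contributes, and there the
    lift is the j-th basis vector. *)
Lemma horizontal_ddb a p j : img' a p ->
  \sum_i \sum_i' horizontal a p j i * conjc (horizontal a p j i') * ddb (lC a) p i i' =
  - curvature N a (base p) j j.
Proof.
move=> /img'P Wp; have [Up z0] := Wp.
have lE := @log_metricE a.
have row0 := @loghomog_ddb_row0 R d _ (@open_dom _ _ _ E a) 1 (lC a) (bC a) lE.
have col0 := @loghomog_ddb_col0 R d _ (@open_dom _ _ _ E a) 1 (lC a) (bC a) lE.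
rewrite (double_sum_base (j := j)).
- rewrite !horizontalS eqxx conjc1 !mul1r -{1}(mkpt_fiber_base p).
  rewrite (@loghomog_ddb_base R d _ (@open_dom _ _ _ E a) 1 (lC a) (bC a) lE _ _ j j Up z0).
  by rewrite /curvature !mxE opprK.
- by move=> i; rewrite (row0 _ _ Wp) mulr0.
- by move=> i; rewrite (col0 _ _ Wp) mulr0.
- by move=> i i' ij; rewrite horizontalS (negPf ij) !mul0r.
- by move=> i i' ij; rewrite [X in conjc X]horizontalS (negPf ij) conjc0 mulr0 mul0r.
Qed.

(** Along one real direction the second derivative of [f] is uncontrolled. Adding the tests along
    the horizontal vector and 'i times it cancels the contribution of [f], and a negative multiple
    of the curvature would have to be nonnegative. *)
Lemma no_pluriharmonic_maximum a (f : Cn R (1 + d) -> R) p (k : R) (j : 'I_d) :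
  smooth_on (img' a) f -> img' a p -> 0 < k -> f p != 0 ->
  ddb (fun q => (f q)%:C) p = 0 ->
  ~ (\forall q \near p, f q ^+ 2 <= f p ^+ 2 * expR (k * log_metric a q - k * log_metric a p)).
Proof.
move=> sf Ip k0 fp ddf0 fle; have oI := @open_img' a.
have sl := @smooth_log_metric a.
(* The one-variable test on the line through [p] in a direction where log |S|^2 is critical. *)
have test v : 'D_v (log_metric a) p = 0 ->
    2 * (f p * 'D_v ('D_v f) p) <= f p ^+ 2 * (k * 'D_v ('D_v (log_metric a)) p).
  move=> Dv0; have [f1 f2] := line_derivatives v oI sf Ip.
  have [l1 l2] := line_derivatives v oI sl Ip.
  have := @squared_exp_test R (fun t => k * log_metric a (t *: v + p))
    (fun t => f (t *: v + p)) (fun t => k * 'D_v (log_metric a) (t *: v + p))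
    (fun t => 'D_v f (t *: v + p)) (k * 'D_v ('D_v (log_metric a)) p) ('D_v ('D_v f) p).
  rewrite !scale0r !add0r; apply => //.
  - by apply: filterS l1 => t l1; exact: is_deriveZ.
  - by rewrite Dv0 mulr0.
  - have cL : {for 0, continuous (fun t : R => t *: v + p)}.
      by apply: differentiable_continuous; exact: differentiableD.
    have g0 : 0 *: v + p = p by rewrite scale0r add0r.
    by move: fle; rewrite -{1}g0 => /cL.
pose c := horizontal a p j; have H0 := horizontal_dz j Ip.
have D1 : 'D_(cvec c) (log_metric a) p = 0.
  by rewrite (derive_cvec_real sl) // H0 /= mulr0.
have D2 : 'D_(cvec (fun i => 'i * c i)) (log_metric a) p = 0.
  rewrite (derive_cvec_real sl) // (_ : \sum_i _ = 0) /= ?mulr0 //.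
  by under eq_bigr do rewrite -mulrA; rewrite -mulr_sumr H0 mulr0.
(* Here x, x' stand for the second derivatives of [f] along the two directions and y, y' for those
   of log |S|^2. *)
have arith (x x' y y' t : R) : 2 * (f p * x) <= f p ^+ 2 * (k * y) ->
    2 * (f p * x') <= f p ^+ 2 * (k * y') -> x + x' = 0 -> y + y' = t -> 0 <= t.
  move=> l1 l2 xx yy; have := lerD l1 l2.
  rewrite -!mulrDr xx yy !mulr0 pmulr_rge0 ?exprn_even_gt0 //.
  by rewrite pmulr_rge0.
have lapf := laplacian_cvec oI sf c Ip.
rewrite [\sum_i _](_ : _ = 0) /= ?mulr0 in lapf; last first.
  by rewrite big1 // => i _; rewrite big1 // => i' _; rewrite ddf0 mxE mulr0.
have lapl := etrans (laplacian_cvec oI sl c Ip)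
  (congr1 (fun x => 4 * complex.Re x) (horizontal_ddb j Ip)).
have := arith _ _ _ _ _ (test _ D1) (test _ D2) lapf lapl.
apply/negP; rewrite -ltNge; have /img'P[Up _] := Ip.
have := curvature_diag_gt0 j Up; rewrite ltcE => /andP[_ c0].
by rewrite pmulr_rlt0 // cReN oppr_lt0.
Qed.

End LocalMaximum.

(** * Attaining the maximum of a radially invariant function on E' *)

Section GlobalMaximum.
Context {R : realType} {d : nat} {D : compactComplexManifold R d} {E : lineBundle D}.
Implicit Types (a b : triv_index E) (z c : R[i]) (w : Cn R d) (e : E).
Local Notation dom a := (cimg (tchart a)).

Definition nonzero e : Prop :=
  exists a, cdom (triv a) e /\ fiber (ccoord (triv a) e) != 0.

Lemma nonzero_point a p : img' a p -> nonzero (cpoint (triv a) p).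
Proof.
move=> [Ip z0]; exists a; split; first exact: cpoint_dom.
by rewrite cpointK.
Qed.

Lemma fiber_transition a b e : cdom (triv a) e -> cdom (triv b) e ->
  fiber (ccoord (triv a) e) != 0 -> fiber (ccoord (triv b) e) != 0.
Proof.
move=> ae be; have [g [_ _ gE]] := triv_transition a b.
by rewrite (gE e ae be) mulf_eq0 negb_or => /andP[].
Qed.

Lemma nonzero_coord a e : nonzero e -> cdom (tchart a) (proj e) ->
  img' a (ccoord (triv a) e).
Proof.
move=> [b [be z0]] /triv_dom ae; split; first exact: ccoord_img.
exact: fiber_transition z0.
Qed.

Lemma proj_point a p : cimg (triv a) p ->
  proj (cpoint (triv a) p) = cpoint (tchart a) (base p).
Proof.
move=> Ip; have ae := cpoint_dom Ip.
have := triv_base ae; rewrite cpointK // => ->.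
by rewrite ccoordK //; apply/triv_dom.
Qed.

Lemma normsq1_le z : normsq z = 1 -> `|complex.Re z| <= 1 /\ `|complex.Im z| <= 1.
Proof.
case: z => x y; rewrite /normsq /= => h.
by rewrite !ler_norml; split; apply/andP; split; nra.
Qed.

(* Over a small box around [t], the function attains its maximum on the compact
   set of unit vectors in the fibre coordinate. *)
Lemma local_max (Q : E -> R) (t : D) :
  (forall a p, img' a p -> {for p, continuous (fun q => Q (cpoint (triv a) q))}) ->
  (forall a z w (s : R), dom a w -> z != 0 ->
     Q (cpoint (triv a) (mkpt ((expR s)%:C * z) w)) = Q (cpoint (triv a) (mkpt z w))) ->
  exists e1, nonzero e1 /\
    \forall t' \near t, forall e, nonzero e -> proj e = t' -> Q e <= Q e1.
Proof.
move=> cQ sQ; have [a at_] := tchart_cover E t.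
pose w0 := ccoord (tchart a) t; have Uw0 : dom a w0 by exact: ccoord_img.
have : nbhs w0 (dom a) by exact: open_nbhs_nbhs (conj (@open_dom _ _ _ E a) Uw0).
move=> /nbhs_ballP[eps /= eps0 Heps]; pose r := eps / 2.
have r0 : 0 < r by rewrite divr_gt0.
have reps : r < eps by rewrite ltr_pdivrMr // ltr_pMr // ltr1n.
pose ctr : Cn R (1 + d) := mkpt 0 w0.
(* Unit fibre vectors have real and imaginary parts in [-1, 1]; in the base, r < eps keeps the
   closed box inside the chart. *)
pose rad (i : 'I_(1 + d)) : R := if i == lshift d 0 then 1 else r.
pose I1 i := `[ctr.1 0 i - rad i, ctr.1 0 i + rad i]%classic.
pose I2 i := `[ctr.2 0 i - rad i, ctr.2 0 i + rad i]%classic.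
pose box : set (Cn R (1 + d)) :=
  [set v : 'rV[R]_(1 + d) | forall i, I1 i (v ord0 i)] `*`
  [set v : 'rV[R]_(1 + d) | forall i, I2 i (v ord0 i)].
have cbox : compact box.
  by apply: compact_setX; apply: rV_compact => i; exact: segment_compact.
pose K : set (Cn R (1 + d)) := box `&` [set p | normsq (fiber p) = 1].
have cK : compact K.
  apply: (subclosed_compact _ cbox); last by move=> p [].
  apply: closedI; first exact: compact_closed.
  rewrite (_ : [set p | _] = (fun p : Cn R (1 + d) => normsq (fiber p)) @^-1` [set 1]) //.
  apply: closed_comp; last exact: closed_eq.
  move=> p _; apply: differentiable_continuous.
  exact: (smooth_on_differentiable (smooth_normsq_fiber openT)).
have radS (j : 'I_d) : rad (rshift 1 j) = r by rewrite /rad eq_rlshift.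
have rad0 : rad (lshift d 0) = 1 by rewrite /rad eqxx.
have ctrS1 (j : 'I_d) : ctr.1 0 (rshift 1 j) = w0.1 0 j by rewrite /ctr /= row_mxEr.
have ctrS2 (j : 'I_d) : ctr.2 0 (rshift 1 j) = w0.2 0 j by rewrite /ctr /= row_mxEr.
have ctr01 : ctr.1 0 (lshift d 0) = 0 by rewrite /ctr /= row_mxEl mxE eqxx.
have ctr02 : ctr.2 0 (lshift d 0) = 0 by rewrite /ctr /= row_mxEl mxE eqxx.
have KU p : K p -> img' a p.
  move=> [[/= b1 b2] n1]; apply/img'P; split; last by rewrite -normsq_gt0 n1.
  apply: Heps; split; split=> // i j; rewrite ord1 /ball /= mxE.
  - have := b1 (rshift 1 j); rewrite /I1 /= in_itv /= radS ctrS1 => /andP[lo hi].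
    by rewrite distrC (le_lt_trans _ reps) // ler_distl lo.
  - have := b2 (rshift 1 j); rewrite /I2 /= in_itv /= radS ctrS2 => /andP[lo hi].
    by rewrite distrC (le_lt_trans _ reps) // ler_distl lo.
have inK z w : normsq z = 1 -> ball w0 r w -> K (mkpt z w).
  move=> n1 [[_ /= B1] [_ /= B2]].
  have zle := normsq1_le n1.
  split; last by rewrite /= fiber_mkpt.
  split=> /= i; rewrite /I1 /I2 /= in_itv /=; case: (split_ordP i) => j ->.
  - rewrite [j]ord1 rad0 ctr01 sub0r add0r row_mxEl mxE eqxx mulr1n -ler_norml.
    by case: zle.
  - rewrite radS ctrS1 row_mxEr -ler_distl distrC; exact: ltW (B1 0 j).
  - rewrite [j]ord1 rad0 ctr02 sub0r add0r row_mxEl mxE eqxx mulr1n -ler_norml.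
    by case: zle.
  - rewrite radS ctrS2 row_mxEr -ler_distl distrC; exact: ltW (B2 0 j).
have K0 : K !=set0 by exists (mkpt 1 w0); apply: inK; [exact: normsq1|exact: ballxx].
have [|p1 /set_mem Kp1 maxp1] := @compact_EVT_max _ R
    (fun q => Q (cpoint (triv a) q)) K K0 cK.
  by apply: continuous_in_subspaceT => p /set_mem/KU; exact: cQ.
exists (cpoint (triv a) p1); split; first exact/nonzero_point/KU.
have nt : nbhs t [set t' | ball w0 r (ccoord (tchart a) t')].
  apply: (ccoord_continuous at_).
  exact: nbhsx_ballx.
have na : nbhs t (cdom (tchart a)).
  exact: open_nbhs_nbhs (conj (open_cdom _) at_).
apply: filterS2 nt na => t' /= Bt' at' e ne et'.
have Ie : img' a (ccoord (triv a) e) by apply: nonzero_coord => //; rewrite et'.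
have /triv_dom ae : cdom (tchart a) (proj e) by rewrite et'.
have := triv_base ae; rewrite et' => Eb.
have [_ z0] := Ie.
rewrite -(ccoordK ae) -(mkpt_fiber_base (ccoord (triv a) e)) Eb.
set z := fiber _ in z0 *.
have n0 : 0 < normsq z by rewrite normsq_gt0.
(* This is -log |z|: scaling by [expR s] reaches the unit vectors without changing [Q]. *)
pose s := - (ln (normsq z) / 2).
have sE : expR s ^+ 2 * normsq z = 1.
  rewrite -expRM_natl /s mulrN mulrCA divff ?pnatr_eq0 // mulr1 expRN lnK ?posrE //.
  by rewrite mulVf // gt_eqF.
rewrite -(sQ a z _ s) //; last exact: ccoord_img.
apply: (maxp1 (mkpt _ _)); apply/mem_set/inK => //.
by rewrite normsqM normsq_real.
Qed.

(** The projections to D of the superlevel sets of [Q] generate a proper filter, stable under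
    intersection because values are totally ordered. By compactness it clusters at some [t]. Every
    superlevel set then has points over each neighbourhood of [t], so the maximum found near [t]
    dominates all values. *)
Lemma global_max (Q : E -> R) (e0 : E) : nonzero e0 ->
  (forall a p, img' a p -> {for p, continuous (fun q => Q (cpoint (triv a) q))}) ->
  (forall a z w (s : R), dom a w -> z != 0 ->
     Q (cpoint (triv a) (mkpt ((expR s)%:C * z) w)) = Q (cpoint (triv a) (mkpt z w))) ->
  exists e1, nonzero e1 /\ forall e, nonzero e -> Q e <= Q e1.
Proof.
move=> ne0 cQ sQ.
pose F : set_system D := [set A | exists e, nonzero e /\
  forall e', nonzero e' -> Q e <= Q e' -> A (proj e')].
have FF : ProperFilter F.
  apply: Build_ProperFilter.
    by move=> [e [ne HA]]; exact: (HA e ne (lexx _)).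
  split.
  - by exists e0.
  - move=> A B [e1 [n1 H1]] [e2 [n2 H2]].
    have [le|/ltW le] := leP (Q e1) (Q e2).
    + exists e2; split=> // e' ne' l'; split; last exact: H2.
      by apply: H1 => //; exact: le_trans l'.
    + exists e1; split=> // e' ne' l'; split; first exact: H1.
      by apply: H2 => //; exact: le_trans l'.
  - by move=> A B AB [e [ne HA]]; exists e; split=> // e' ne' l'; apply/AB/HA.
have FT : F setT by exists e0.
have [t [_ ct]] := @carrier_compact _ _ D F FF FT.
have [e1 [n1 Ht]] := local_max t cQ sQ.
exists e1; split=> // e ne.
have [|t' [[e' [ne' [l' <-]]] /(_ e' ne' erefl)]] :=
    ct [set t' | exists e', nonzero e' /\ Q e <= Q e' /\ proj e' = t'] _ _ Ht.
  by exists e; split=> // e' ne' l'; exists e'.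
exact: le_trans.
Qed.

End GlobalMaximum.

(** * Fibrewise multiplication as a global map of the bundle *)

Section FiberRotation.
Context {R : realType} {d : nat} {D : compactComplexManifold R d} {E : lineBundle D}.
Implicit Types (a b : triv_index E) (z c : R[i]) (e : E).

(** Smoothness on E' concerns functions on all of [E], so a globally defined map is required. A
    trivialization is picked by choice, and [rot_chart] shows that the result does not depend on
    it. *)
Definition rot c e : E :=
  let a := sval (cid (tchart_cover E (proj e))) in
  cpoint (triv a) (rotate c (ccoord (triv a) e)).

Lemma fiber_rotate c (p : Cn R (1 + d)) : fiber (rotate c p) = c * fiber p.
Proof. by rewrite /rotate fiber_mkpt. Qed.

Lemma base_rotate c (p : Cn R (1 + d)) : base (rotate c p) = base p.
Proof. by rewrite /rotate base_mkpt. Qed.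

Lemma cimg_rotate a c p : cimg (triv a) (rotate c p) <-> cimg (triv a) p.
Proof. by rewrite !triv_img base_rotate. Qed.

(** A transition multiplies the fibre coordinate by a number depending on the base point only, which
    commutes with multiplication by [c]. *)
Lemma rot_chart a b c e : cdom (triv a) e -> cdom (triv b) e ->
  cpoint (triv b) (rotate c (ccoord (triv b) e)) =
  cpoint (triv a) (rotate c (ccoord (triv a) e)).
Proof.
move=> ae be; set e' := cpoint (triv b) _.
have Ib : cimg (triv b) (rotate c (ccoord (triv b) e)).
  by apply/cimg_rotate; exact: ccoord_img.
have be' : cdom (triv b) e' by exact: cpoint_dom.
have pe' : proj e' = proj e.
  rewrite /e' proj_point // base_rotate triv_base // ccoordK //.
  exact/triv_dom.
have ae' : cdom (triv a) e' by apply/triv_dom; rewrite pe'; apply/triv_dom.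
rewrite -(ccoordK ae'); congr (cpoint _ _).
rewrite -[LHS]mkpt_fiber_base /rotate; congr (mkpt _ _).
- have [g [_ _ gE]] := triv_transition a b.
  rewrite (gE e' ae' be') (gE e ae be) /e' cpointK // fiber_rotate pe'.
  by rewrite mulrCA.
- by rewrite !triv_base // pe'.
Qed.

Lemma rotE a c e : cdom (triv a) e ->
  rot c e = cpoint (triv a) (rotate c (ccoord (triv a) e)).
Proof.
move=> ae; apply: rot_chart => //; apply/triv_dom.
exact: (svalP (cid (tchart_cover E (proj e)))).
Qed.

Lemma rot_point a c p : cimg (triv a) p ->
  rot c (cpoint (triv a) p) = cpoint (triv a) (rotate c p).
Proof.
by move=> Ip; rewrite (rotE _ (cpoint_dom Ip)) cpointK.
Qed.

End FiberRotation.

(** * Locality and linearity of the complex Hessian *)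

Section DdbRules.
Context {R : realType} {m : nat}.
Implicit Types (f g : Cn R m -> R[i]) (W : set (Cn R m)).

Lemma ddbE f p i j : ddb f p i j = dz i (dzb j f) p.
Proof. by rewrite mxE. Qed.

Lemma eq_ddb W f g p : open W -> W p -> (forall q, W q -> f q = g q) ->
  ddb f p = ddb g p.
Proof.
move=> oW Wp fg; have nW q : W q -> {near q, f =1 g}.
  by move=> Wq; apply: (@filterS _ _ _ W); [exact: fg|exact: open_nbhs_nbhs (conj oW Wq)].
apply/matrixP => i j; rewrite [LHS]ddbE [RHS]ddbE; apply: dz_near.
apply: (@filterS _ _ _ W); last exact: open_nbhs_nbhs (conj oW Wp).
by move=> q Wq; apply: dzb_near; exact: nW.
Qed.

Lemma ddbZ W (k : R[i]) f p : open W -> csmooth_on W f -> W p ->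
  ddb (fun q => k * f q) p = k *: ddb f p.
Proof.
move=> oW sf Wp; apply/matrixP => i j; rewrite [RHS]mxE [LHS]ddbE [X in _ = _ * X]ddbE.
have near_j : {near p, (fun q => k * dzb j f q) =1 dzb j (fun q => k * f q)}.
  apply: (@filterS _ _ _ W); last exact: open_nbhs_nbhs (conj oW Wp).
  move=> q Wq /=.
  by rewrite (wirtinger_dzb (wirtingerZ k (csmooth_wirtinger j sf Wq))).
rewrite -(dz_near _ near_j).
exact: wirtinger_dz (wirtingerZ k (csmooth_wirtinger i (csmooth_dzb oW j sf) Wp)).
Qed.

Lemma ddbD W f g p : open W -> csmooth_on W f -> csmooth_on W g -> W p ->
  ddb (fun q => f q + g q) p = ddb f p + ddb g p.
Proof.
move=> oW sf sg Wp; apply/matrixP => i j.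
rewrite [RHS]mxE [LHS]ddbE [X in _ = X + _]ddbE [X in _ = _ + X]ddbE.
have near_j : {near p, (fun q => dzb j f q + dzb j g q) =1 dzb j (fun q => f q + g q)}.
  apply: (@filterS _ _ _ W); last exact: open_nbhs_nbhs (conj oW Wp).
  move=> q Wq /=.
  by rewrite (wirtinger_dzb (wirtingerD (csmooth_wirtinger j sf Wq) (csmooth_wirtinger j sg Wq))).
rewrite -(dz_near _ near_j).
exact: wirtinger_dz (wirtingerD (csmooth_wirtinger i (csmooth_dzb oW j sf) Wp)
  (csmooth_wirtinger i (csmooth_dzb oW j sg) Wp)).
Qed.

Definition evec (j : 'I_m) (x : R[i]) : Cn R m := cvec (fun i => if i == j then x else 0).

Lemma evecE j x : evec j x = complex.Re x *: ex R j + complex.Im x *: ey R j.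
Proof.
rewrite /evec cvecE (bigD1 j) //= eqxx big1 ?addr0 // => i ij.
by rewrite (negPf ij) /= !scale0r addr0.
Qed.

Lemma cderive_evec g p j x : cdiff g p ->
  cderive (evec j x) g p = x * dz j g p + conjc x * dzb j g p.
Proof.
move=> dg; rewrite /evec cderive_cvec // (bigD1 j) //= eqxx big1 ?addr0 // => i ij.
by rewrite (negPf ij) conjc0 !mul0r addr0.
Qed.

Lemma lie_fun_cderive (X : 'I_m -> Cn R m -> R[i]) g p : cdiff g p ->
  lie_fun X g p = cderive (cvec (fun i => X i p)) g p.
Proof. by move=> dg; rewrite cderive_cvec. Qed.

End DdbRules.

(** * Pullback by fibrewise multiplication and Euler's relation *)

Section Rotation.
Context {R : realType} {d : nat}.
Implicit Types (f : Cn R (1 + d) -> R[i]) (p : Cn R (1 + d)) (c : R[i]) (j : 'I_(1 + d)).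
Local Notation l0 := (lshift d 0).
Local Notation rs := (rshift 1).

(** The diagonal entries of the complex Jacobian of [rotate c]. *)
Definition rot_coef c j : R[i] := if j == l0 then c else 1.

Lemma mkpt00 : mkpt 0 0 = 0 :> Cn R (1 + d).
Proof. by rewrite /mkpt /= !raddf0 !row_mx0. Qed.

Lemma rotate_ex c j : rotate c (ex R j) = evec j (rot_coef c j).
Proof.
rewrite evecE /rot_coef; case: (split_ordP j) => i ->.
- rewrite (ord1 i) eqxx /rotate fiber_ex0 base_ex0 mulr1 ex0E ey0E.
  rewrite -[_ *: mkpt 'i 0]addr0 -mkpt00 -!mkpt_linear !scaler0 !addr0 mulr1 [_ * 'i]mulrC; congr (mkpt _ _).
  exact: complexE.
- rewrite eq_rlshift /= scale1r scale0r addr0 /rotate fiber_exS base_exS mulr0.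
  by rewrite exSE.
Qed.

Lemma rotate_ey c j : rotate c (ey R j) = evec j ('i * rot_coef c j).
Proof.
rewrite evecE /rot_coef; case: (split_ordP j) => i ->.
- rewrite (ord1 i) eqxx /rotate fiber_ey0 base_ey0 ex0E ey0E.
  rewrite -[_ *: mkpt 'i 0]addr0 -mkpt00 -!mkpt_linear !scaler0 !addr0 mulr1 [c * _]mulrC [_%:C * 'i]mulrC.
  by congr (mkpt _ _); exact: complexE.
- rewrite eq_rlshift mulr1 /= scale1r scale0r add0r /rotate fiber_eyS base_eyS mulr0.
  by rewrite eySE.
Qed.

Lemma wirtinger_rotate f p c j : cdiff f (rotate c p) ->
  wirtinger j (fun q => f (rotate c q)) p
    (rot_coef c j * dz j f (rotate c p)) (conjc (rot_coef c j) * dzb j f (rotate c p)).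
Proof.
move=> df; split; apply: (is_cderive_affine (rotate_linear c)).
- rewrite rotate_ex -cderive_evec //; exact: cdiff_is_cderive.
- rewrite rotate_ey mulrBr mulrA [X in _ - X]mulrA -mulNr -[- _]mulNr.
  have -> : - 'i * conjc (rot_coef c j) = conjc ('i * rot_coef c j).
    by rewrite rmorphM /= conjci.
  rewrite -cderive_evec //; exact: cdiff_is_cderive.
Qed.

Lemma ddb_rotate (W : set (Cn R (1 + d))) f p c i j : open W -> csmooth_on W f ->
  (forall q, W q -> W (rotate c q)) -> W p ->
  ddb (fun q => f (rotate c q)) p i j =
  rot_coef c i * conjc (rot_coef c j) * ddb f (rotate c p) i j.
Proof.
move=> oW sf rW Wp; rewrite [LHS]ddbE [X in _ = _ * X]ddbE.
have near_j : {near p, (fun q => conjc (rot_coef c j) * dzb j f (rotate c q)) =1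
    dzb j (fun q => f (rotate c q))}.
  apply: (@filterS _ _ _ W); last exact: open_nbhs_nbhs (conj oW Wp).
  move=> q Wq /=.
  by rewrite (wirtinger_dzb (wirtinger_rotate j (csmooth_cdiff sf (rW _ Wq)))).
rewrite -(dz_near _ near_j).
have sj := csmooth_cdiff (csmooth_dzb oW j sf) (rW _ Wp).
rewrite (wirtinger_dz (wirtingerZ (conjc (rot_coef c j)) (wirtinger_rotate i sj))).
by rewrite mulrA [conjc _ * _]mulrC.
Qed.

Lemma csmooth_rotate (W : set (Cn R (1 + d))) f c : csmooth_on W f ->
  (forall q, W q -> W (rotate c q)) -> csmooth_on W (fun q => f (rotate c q)).
Proof.
move=> [sr si] rW; split; apply: (smooth_on_sub rW).
- exact: (smooth_on_affine (rotate_linear c) (@differentiable_rotate _ _ c) sr).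
- exact: (smooth_on_affine (rotate_linear c) (@differentiable_rotate _ _ c) si).
Qed.

Lemma cvec_Vhol p : cvec (fun i => Vhol i p) = mkpt (fiber p) 0.
Proof.
rewrite (_ : cvec _ = evec l0 (rot_coef (fiber p) l0)).
  by rewrite -rotate_ex /rotate fiber_ex0 base_ex0 mulr1.
by rewrite /evec /rot_coef eqxx.
Qed.

Lemma scale_mkpt0 (t : R) z : t *: mkpt z 0 = mkpt (t%:C * z) 0 :> Cn R (1 + d).
Proof.
by rewrite -[LHS]addr0 -mkpt00 -mkpt_linear addr0 scaler0 addr0.
Qed.

Lemma radial_derive (g : Cn R (1 + d) -> R) p (t : R) :
  differentiable g (rotate (expR t)%:C p) ->
  is_derive t 1 (fun x => g (rotate (expR x)%:C p))
    ('D_(mkpt (fiber (rotate (expR t)%:C p)) 0) g (rotate (expR t)%:C p)).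
Proof.
pose v : Cn R (1 + d) := mkpt (fiber p) 0; pose L (x : R) := x *: v + mkpt 0 (base p).
have qE x : rotate (expR x)%:C p = L (expR x).
  by rewrite /L -mkpt_linear addr0 scaler0 add0r.
have HL (x y x' : R) : L (x *: y + x') = x *: (y *: v) + L x'.
  by rewrite /L scalerDl scalerA addrA.
rewrite fiber_rotate -scale_mkpt0 -/v; under eq_fun do rewrite qE.
rewrite qE => dg.
have dL : is_derive (expR t) 1 (fun x => g (L x)) ('D_v g (L (expR t))).
  apply: DeriveDef.
    rewrite (@derivable_affine _ _ _ L (fun x : R => x *: v) g _ 1 HL) scale1r.
    exact/diff_derivable.
  by rewrite (@derive_affine _ _ _ L (fun x : R => x *: v) g _ 1 HL) scale1r.
apply: is_derive_eq (is_derive1_comp dL (is_derive_expR t)) _.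
by rewrite !deriveE // linearZ mulrC.
Qed.

Lemma euler_derive (g : Cn R (1 + d) -> R) p (k : R) : differentiable g p ->
  (forall t, g (rotate (expR t)%:C p) = expR (k * t) * g p) ->
  'D_(mkpt (fiber p) 0) g p = k * g p.
Proof.
have r0 : rotate (expR 0)%:C p = p by rewrite expR0 /rotate mul1r mkpt_fiber_base.
move=> dg gE; have := @radial_derive g p 0; rewrite r0 => /(_ dg) [_ <-].
under eq_fun do rewrite gE.
have [_ ->] := is_deriveM (is_derive_expRZ k 0) (is_derive_cst (g p) (0 : R) 1).
by rewrite /GRing.scale /= !mulr0 expR0 mulr1 add0r mulrC.
Qed.

End Rotation.

(** * Functions of given weight, and vanishing of pluriharmonic ones *)

Section Soliton.
Context {R : realType} {d : nat} {D : compactComplexManifold R d} {E : lineBundle D}.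
Variable N : E -> R.
Hypothesis hN : hermitian_metric N.
Hypothesis hK : forall a : triv_index E, kahler_on (cimg (tchart a)) (curvature N a).
Implicit Types (a : triv_index E) (z c : R[i]) (w : Cn R d) (f : E -> R).
Local Notation l0 := (lshift d 0).
Local Notation rs := (rshift 1).
Local Notation dom a := (cimg (tchart a)).

(** The integrated form of weight k. Unlike [homogeneous], it leaves the dependence on the argument
    of z free. *)
Definition scaling (k : nat) f : Prop := forall a z w (s : R), dom a w -> z != 0 ->
  f (cpoint (triv a) (mkpt ((expR s)%:C * z) w)) =
  expR (k%:R * s) * f (cpoint (triv a) (mkpt z w)).

Lemma ln_metric a z w : dom a w -> z != 0 ->
  ln (N (cpoint (triv a) (mkpt z w))) = log_metric N a (mkpt z w).
Proof.
move=> Uw z0; rewrite (metricE hN _ Uw) /log_metric base_mkpt fiber_mkpt.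
by rewrite lnM // posrE ?normsq_gt0 // (weight_gt0 hN).
Qed.

Lemma expRC_neq0 (s : R) : (expR s)%:C != 0.
Proof. by rewrite eq_complex /= expR_eq0. Qed.

Lemma smooth'_real f a : smooth' f -> smooth_on (img' a) (fun p => f (cpoint (triv a) p)).
Proof. by move=> sf; have [] := sf a. Qed.

(** The index [j] is there to provide a horizontal direction for the maximum principle. *)
Lemma pluriharmonic_zero (k : nat) f (j : 'I_d) : (0 < k)%N -> smooth' f ->
  scaling k f -> (forall a p, img' a p -> ddb (local_fun f a) p = 0) ->
  forall a p, img' a p -> f (cpoint (triv a) p) = 0.
Proof.
move=> k0 sf hf ddf a0 p0 Ip0.
(* On E' this is f^2 / |S|^(2k). Numerator and denominator both have weight 2k, hence the radial
   invariance that [global_max] requires; the exponential form suits [squared_exp_test]. *)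
pose Q (e : E) : R := f e ^+ 2 * expR (- (k%:R * ln (N e))).
have QE a p : img' a p -> Q (cpoint (triv a) p) =
    f (cpoint (triv a) p) ^+ 2 * expR (- (k%:R * log_metric N a p)).
  move: p; apply: img'_ind => z w Uw z0.
  by rewrite /Q ln_metric.
have [||e1 [[a1 [ae1 z1]] max1]] := @global_max _ _ _ E Q _ (nonzero_point Ip0).
- move=> a p Ip; apply: differentiable_continuous.
  apply: (@differentiable_near_eq _ _ (fun p => f (cpoint (triv a) p) * f (cpoint (triv a) p) *
    expR (- (k%:R * log_metric N a p)))).
    apply: (@filterS _ _ _ (img' a)); last first.
      exact: open_nbhs_nbhs (conj (@open_img' _ _ _ E a) Ip).
    by move=> q Iq /=; rewrite QE // expr2.
  have df := smooth_on_differentiable (smooth'_real (a := a) sf) Ip.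
  have dl := smooth_on_differentiable (smooth_log_metric hN (a := a)) Ip.
  apply: differentiableM; first exact: differentiableM.
  apply: (@differentiable_comp _ _ _ _ (fun p => - (k%:R * log_metric N a p)) expR).
    by apply: differentiableN; exact: (differentiableZ k%:R dl).
  exact/derivable1_diffP/derivable_expR.
- move=> a z w s Uw z0; have es0 := expRC_neq0 s.
  rewrite !QE; [|exact: img'_mkpt|by apply: img'_mkpt => //; rewrite mulf_neq0].
  rewrite hf // /log_metric !base_mkpt !fiber_mkpt normsqM normsq_real.
  rewrite lnM ?posrE ?normsq_gt0 ?exprn_gt0 ?expR_gt0 // lnXn ?expR_gt0 // expRK.
  rewrite exprMn -expRM_natl mulrAC -expRD [RHS]mulrC; congr (expR _ * _).
  by rewrite -mulr_natr; ring.
have Ip1 : img' a1 (ccoord (triv a1) e1) by split => //; exact: ccoord_img.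
pose p1 := ccoord (triv a1) e1; have e1E : cpoint (triv a1) p1 = e1 by exact: ccoordK.
(* If [f] vanishes where [Q] is maximal, then [Q], a square times a positive factor, is at most 0 on
   all of E'. *)
have [f1|f1] := eqVneq (f e1) 0.
  have := max1 _ (nonzero_point Ip0).
  rewrite {2}/Q f1 expr0n mul0r /Q pmulr_lle0 ?expR_gt0 // => le0.
  by apply/eqP; rewrite -sqrf_eq0 eq_le le0 sqr_ge0.
exfalso; have kR : 0 < k%:R :> R by rewrite ltr0n.
apply: (@no_pluriharmonic_maximum _ _ _ E N hN hK a1
    (fun p => f (cpoint (triv a1) p)) p1 k%:R j) => //.
- exact: smooth'_real.
- by rewrite e1E.
- exact: ddf.
apply: (@filterS _ _ _ (img' a1)); last first.
  exact: open_nbhs_nbhs (conj (@open_img' _ _ _ E a1) Ip1).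
move=> q Iq /=; have := max1 _ (nonzero_point Iq); rewrite -e1E !QE //.
rewrite expRN ler_pdivrMr ?expR_gt0 // -mulrA => le.
by rewrite addrC expRD.
Qed.

(** Along a radial orbit, [weight] is the differential equation f' = k f, so f times exp(-k t) has
    zero derivative. *)
Lemma weight_scaling (k : nat) f : smooth' f -> weight k%:Z f -> scaling k f.
Proof.
move=> sf wf a z w s Uw z0.
pose fR p := f (cpoint (triv a) p); pose q (t : R) := rotate (expR t)%:C (mkpt z w).
have qE t : q t = mkpt ((expR t)%:C * z) w by rewrite /q /rotate fiber_mkpt base_mkpt.
have Iq t : img' a (q t).
  by rewrite qE; apply: img'_mkpt => //; rewrite mulf_neq0 // expRC_neq0.
have df t : differentiable fR (q t).
  exact: (smooth_on_differentiable (smooth'_real (a := a) sf) (Iq t)).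
have euler t : 'D_(mkpt (fiber (q t)) 0) fR (q t) = k%:R * fR (q t).
  have := wf a _ (Iq t); rewrite lie_fun_cderive; last exact: csmooth_cdiff (sf a) (Iq t).
  rewrite cvec_Vhol cderive_real => /(congr1 (@complex.Re R)).
  have -> : k%:~R * local_fun f a (q t) = (k%:R * fR (q t))%:C.
    by rewrite rmorphM rmorph_nat.
  by [].
have h0 (t : R) : is_derive t 1 (fun x => fR (q x) * expR (- k%:R * x)) 0.
  apply: is_derive_eq (is_deriveM (radial_derive (df t)) (is_derive_expRZ (- k%:R) t)) _.
  by rewrite -/(q t) euler /GRing.scale /=; ring.
have := is_derive_0_is_cst s 0 h0; rewrite mulr0 expR0 mulr1 mulNr expRN.
rewrite !qE expR0 mul1r => h; rewrite -[LHS]/(fR _) -[X in _ = _ * X]/(fR _) -h.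
by rewrite [RHS]mulrC mulfVK // expR_eq0.
Qed.

Lemma img'_rotate a c p : c != 0 -> img' a p -> img' a (rotate c p).
Proof.
by move=> c0 [Ip z0]; split; [exact/cimg_rotate|rewrite fiber_rotate mulf_neq0].
Qed.

(** The Hessian of [f] composed with the scaling is computed twice, by the chain rule and by
    homogeneity. Each fibre index costs one factor exp t of the Jacobian. *)
Lemma ddb_scaling (k : nat) f a p (t : R) (i j : 'I_(1 + d)) :
  smooth' f -> scaling k f -> img' a p ->
  ddb (local_fun f a) (rotate (expR t)%:C p) i j =
  (expR ((k%:R - (i == l0)%:R - (j == l0)%:R) * t))%:C * ddb (local_fun f a) p i j.
Proof.
move=> sf hf Ip; pose c : R[i] := (expR t)%:C; have c0 : c != 0 by exact: expRC_neq0.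
have oI := @open_img' _ _ _ E a.
have E1 := ddb_rotate i j oI (sf a) (fun q => img'_rotate c0) Ip.
have E2 : ddb (fun q => local_fun f a (rotate c q)) p =
    (expR (k%:R * t))%:C *: ddb (local_fun f a) p.
  rewrite -(ddbZ _ oI (sf a) Ip); apply: (eq_ddb oI Ip) => q.
  move: q; apply: img'_ind => z w Uw z0.
  by rewrite /local_fun /rotate fiber_mkpt base_mkpt hf // rmorphM.
have cE (l : 'I_(1 + d)) : rot_coef c l = (expR ((l == l0)%:R * t))%:C.
  by rewrite /rot_coef; case: eqP => _; rewrite ?mul1r // mul0r expR0.
rewrite E2 [LHS]mxE !cE conjc_real -rmorphM -expRD in E1.
have solve (x y : R[i]) (r s : R) : (expR r)%:C * x = (expR s)%:C * y ->
    y = (expR (r - s))%:C * x.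
  move=> xy; apply: (mulfI (expRC_neq0 s)).
  by rewrite -xy mulrA -rmorphM -expRD addrC subrK.
have -> : (k%:R - (i == l0)%:R - (j == l0)%:R) * t =
  k%:R * t - ((i == l0)%:R * t + (j == l0)%:R * t) by ring.
exact: solve E1.
Qed.

Lemma sum_fiber_derivatives (M : 'M[R[i]]_(1 + d)) i j :
  \sum_l (M l j * ((l == l0) && (i == l0))%:R + M i l * ((l == l0) && (j == l0))%:R) =
  ((i == l0)%:R + (j == l0)%:R) * M i j.
Proof.
rewrite big_split /= (bigD1 l0) //= ?eqxx [X in _ + X + _]big1 ?addr0; last first.
  by move=> l /negPf ->; rewrite mulr0.
rewrite (bigD1 l0) //= ?eqxx [X in _ + (_ + X)]big1 ?addr0; last first.
  by move=> l /negPf ->; rewrite mulr0.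
rewrite mulrDl; congr (_ + _).
- by case: eqP => [->|_]; rewrite ?mulr1 ?mul1r ?mulr0 ?mul0r.
- by case: eqP => [->|_]; rewrite ?mulr1 ?mul1r ?mulr0 ?mul0r.
Qed.

(** By Euler's relation each coefficient has weight k minus its number of fibre indices;
    differentiating the components of V restores exactly that number. *)
Lemma lie_form_scaling (k : nat) f a p : smooth' f -> scaling k f -> img' a p ->
  lie_form (@Vhol R d) (ddb (local_fun f a)) p = k%:R *: ddb (local_fun f a) p.
Proof.
move=> sf hf Ip; apply/matrixP => i j; rewrite [LHS]mxE [RHS]mxE.
have sg : csmooth_on (img' a) (fun q => ddb (local_fun f a) q i j).
  have -> : (fun q => ddb (local_fun f a) q i j) = dz i (dzb j (local_fun f a)).
    by apply/funext => q; exact: ddbE.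
  have oI := @open_img' _ _ _ E a.
  by apply: csmooth_dz => //; apply: csmooth_dzb => //; exact: sf.
have dg := csmooth_cdiff sg Ip; have [dr di] := dg.
rewrite lie_fun_cderive // cvec_Vhol.
pose kij : R := k%:R - (i == l0)%:R - (j == l0)%:R.
have -> : cderive (mkpt (fiber p) 0) (fun q => ddb (local_fun f a) q i j) p =
    kij%:C * ddb (local_fun f a) p i j.
  apply: complexP; rewrite ?cRe_realM ?cIm_realM.
  - apply: (euler_derive dr) => t.
    exact: etrans (congr1 (@complex.Re R) (ddb_scaling t i j sf hf Ip)) (cRe_realM _ _).
  - apply: (euler_derive di) => t.
    exact: etrans (congr1 (@complex.Im R) (ddb_scaling t i j sf hf Ip)) (cIm_realM _ _).
have dzV (l : 'I_(1 + d)) : dz i (Vhol l) p = ((l == l0) && (i == l0))%:R.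
  rewrite /Vhol; case: (l == l0) => /=; last exact: wirtinger_dz (wirtinger_cst i p 0).
  case: (split_ordP i) => i' ->; first by rewrite (ord1 i') eqxx (wirtinger_dz (wirtinger_fiber0 p)).
  by rewrite eq_rlshift (wirtinger_dz (wirtinger_fiberS p i')).
have dzbV (l : 'I_(1 + d)) : dzb j (fun q => conjc (Vhol l q)) p = ((l == l0) && (j == l0))%:R.
  rewrite /Vhol; case: (l == l0) => /=.
    case: (split_ordP j) => j' ->.
      by rewrite (ord1 j') eqxx (wirtinger_dzb (wirtinger_conj (wirtinger_fiber0 p))) conjc1.
    by rewrite eq_rlshift (wirtinger_dzb (wirtinger_conj (wirtinger_fiberS p j'))) conjc0.
  by rewrite (wirtinger_dzb (wirtinger_cst j p (conjc 0))).
under eq_bigr do rewrite dzV dzbV.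
rewrite sum_fiber_derivatives -mulrDl; congr (_ * _).
by rewrite /kij !rmorphB !rmorph_nat; ring.
Qed.

End Soliton.

(** * Circle invariance of the coefficients of the soliton *)

Section CircleInvariance.
Context {R : realType} {d : nat} {D : compactComplexManifold R d} {E : lineBundle D}.
Variables (N : E -> R) (u : nat -> E -> R).
Hypothesis hN : hermitian_metric N.
Hypothesis hK : forall a : triv_index E, kahler_on (cimg (tchart a)) (curvature N a).
Hypothesis hS : formal_expanding_soliton N u.
Implicit Types (a : triv_index E) (z c : R[i]) (w : Cn R d) (k : nat).
Local Notation l0 := (lshift d 0).
Local Notation dom a := (cimg (tchart a)).
Local Notation T a k := (fun q => trlog (perturbation N u a q) k).

Lemma soliton_smooth k : (0 < k)%N -> smooth' (u k).
Proof. by move=> k0; have [] := hS.1 k k0. Qed.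

Lemma soliton_scaling k : (0 < k)%N -> scaling k (u k).
Proof. by move=> k0; have [] := hS.1 k k0; exact: weight_scaling. Qed.

Lemma omega_pos k a : (0 < k)%N -> omega N u k%:Z a = ddb (local_fun (u k) a).
Proof. by case: k. Qed.

Lemma ricci_omega_pos k a p : (0 < k)%N -> ricci_omega N u k%:Z a p = - ddb (T a k) p.
Proof.
move=> k0; have [e1 e2] : (k%:Z == 0) = false /\ (0 < k%:Z) = true by case: k k0.
by rewrite /ricci_omega e1 e2.
Qed.

(** The weight k part of the equation reads -ddb T + (k/2) ddb u = -ddb u. It ties T to (k/2 + 1) u
    only up to pluriharmonic functions, which is why invariance of T does not pass to u at once. *)
Lemma ddb_trlog k a p : (0 < k)%N -> img' a p ->
  ddb (T a k) p = (k%:R / 2 + 1) *: ddb (local_fun (u k) a) p.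
Proof.
move=> k0 Ip; have := hS.2 k%:Z a p Ip.
rewrite ricci_omega_pos // omega_pos //.
rewrite (lie_form_scaling (soliton_smooth k0) (soliton_scaling k0) Ip).
move: (ddb (T a k) p) (ddb (local_fun (u k) a) p) => Y X YX.
have XE : X = Y - 2^-1 *: (k%:R *: X) by rewrite -[LHS]opprK -YX opprD opprK.
by rewrite scalerDl scale1r {2}XE scalerA [_^-1 * _]mulrC addrC subrK.
Qed.

(* The coefficient of [|z|^k] in the trace of the logarithm is a second
   derivative of [u k], hence smooth. *)
Lemma csmooth_trlog k a : (0 < k)%N ->
  (forall j, (0 < j < k)%N -> homogeneous (j%:R / 2) (u j)) ->
  csmooth_on (dom a) (fun w => T a k (mkpt 1 w)).
Proof.
move=> k0 hu; have oI := @open_img' _ _ _ E a.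
have TE z w : dom a w -> z != 0 -> T a k (mkpt z w) =
    (rho (k%:R / 2) z)%:C * T a k (mkpt 1 w).
  by move=> Uw z0; apply: (trlog_perturbation_scale hN hK) => // j; exact: soliton_smooth.
(* At z = 1 the fibre-fibre entry of ddb T is (k/2)^2 T, and by [ddb_trlog] it is also k/2 + 1 times
   that of ddb u. *)
pose r : R[i] := (k%:R / 2 + 1) / (k%:R / 2) ^+ 2.
have s00 : csmooth_on (dom a) (fun w => dz l0 (dzb l0 (local_fun (u k) a)) (mkpt 1 w)).
  apply: csmooth_section; apply: csmooth_dz => //; apply: csmooth_dzb => //.
  exact: soliton_smooth.
apply: (@eq_csmooth _ _ _ (@open_dom _ _ _ E a) _ _ _ (csmoothZ (@open_dom _ _ _ E a) r s00)).
move=> w Uw; have n1 := @oner_neq0 R[i].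
have I1 := img'_mkpt Uw n1; have W1 := (img'P _ _).1 I1.
have := @homog_ddb00 R d _ (@open_dom _ _ _ E a) (k%:R / 2) (T a k)
  (fun w => T a k (mkpt 1 w)) TE _ W1.
rewrite (ddb_trlog k0 I1) mxE ddbE base_mkpt fiber_mkpt rho_of1 conjc1 !mulr1 invr1 mulr1.
have -> : (k%:R / 2)%:C = k%:R / 2 :> R[i] by rewrite rmorphM fmorphV !rmorph_nat.
have k2 : k%:R / 2 != 0 :> R[i] by rewrite mulf_neq0 ?invr_eq0 ?pnatr_eq0 // -lt0n.
have solve (x t s q : R[i]) : q != 0 -> s * x = q * t -> s / q * x = t.
  by move=> q0 e; rewrite mulrAC e mulrAC mulfV // mul1r.
exact: solve (expf_neq0 2 k2).
Qed.

(** Division by k/2 + 1 carries the scaling of ddb T over to ddb u, before anything is known about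
    rotations of u itself. *)
Lemma ddb_potential_scale k a z w : (0 < k)%N ->
  (forall j, (0 < j < k)%N -> homogeneous (j%:R / 2) (u j)) -> dom a w -> z != 0 ->
  ddb (local_fun (u k) a) (mkpt z w) = (rho (k%:R / 2) z)%:C *:
    (coframe z *m ddb (local_fun (u k) a) (mkpt 1 w) *m coframe_conj z).
Proof.
move=> k0 hu Uw z0; have n1 := @oner_neq0 R[i].
have TE z' w' : dom a w' -> z' != 0 -> T a k (mkpt z' w') =
    (rho (k%:R / 2) z')%:C * T a k (mkpt 1 w').
  by move=> Uw' z0'; apply: (trlog_perturbation_scale hN hK) => // j; exact: soliton_smooth.
have := @homog_ddb R d _ (@open_dom _ _ _ E a) (k%:R / 2) (T a k)
  (fun w => T a k (mkpt 1 w)) TE (csmooth_trlog a k0 hu) _ _ Uw z0.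
rewrite (ddb_trlog k0 (img'_mkpt Uw z0)) (ddb_trlog k0 (img'_mkpt Uw n1)).
have r0 : k%:R / 2 + 1 != 0 :> R[i].
  by rewrite gt_eqF // ltr_wpDl // divr_ge0 // ler0n.
move: (ddb _ (mkpt z w)) (ddb _ (mkpt 1 w)) => X Y.
rewrite -scalemxAr -scalemxAl scalerA [_ * (_ + 1)]mulrC -scalerA.
have cancel (r : R[i]) (A B : 'M[R[i]]_(1 + d)) : r != 0 -> r *: A = r *: B -> A = B.
  by move=> rn0 /(congr1 (fun M => r^-1 *: M)); rewrite !scalerA mulVf // !scale1r.
exact: cancel r0.
Qed.

Lemma rot_fiber_coef c z (i : 'I_(1 + d)) : c != 0 -> z != 0 ->
  rot_coef c i * fiber_coef (c * z) i = fiber_coef z i :> R[i].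
Proof.
move=> c0 z0; rewrite /rot_coef /fiber_coef; case: (i == l0); last by rewrite mulr1.
by rewrite invfM mulrA mulfV // mul1r.
Qed.

(** For |c| = 1 the powers of |z| and |c z| agree, and the Jacobian of the rotation cancels the
    passage from the coframe at c z to that at z. *)
Lemma rot_entry (k : R) c z (X Y Z : 'M[R[i]]_(1 + d)) i j :
  c != 0 -> z != 0 -> normsq c = 1 ->
  X = (rho k (c * z))%:C *: (coframe (c * z) *m Y *m coframe_conj (c * z)) ->
  Z = (rho k z)%:C *: (coframe z *m Y *m coframe_conj z) ->
  rot_coef c i * conjc (rot_coef c j) * X i j = Z i j.
Proof.
move=> c0 z0 c1 -> ->; rewrite [RHS]mxE [X in _ * X = _]mxE !coframe_mulE rhoM // (rho_unit _ c1) mul1r.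
by rewrite -(rot_fiber_coef i c0 z0) -(rot_fiber_coef j c0 z0) rmorphM /=; ring.
Qed.

Lemma circle_invariant k c a z w (j : 'I_d) : (0 < k)%N -> normsq c = 1 ->
  (forall j, (0 < j < k)%N -> homogeneous (j%:R / 2) (u j)) -> dom a w -> z != 0 ->
  u k (cpoint (triv a) (mkpt (c * z) w)) = u k (cpoint (triv a) (mkpt z w)).
Proof.
move=> k0 c1 hu Uw z0; have c0 : c != 0 by rewrite -normsq_gt0 c1.
have su := soliton_smooth k0; have hs := soliton_scaling k0.
pose psi (e : E) := u k (rot c e) - u k e.
have psiE b p : img' b p -> psi (cpoint (triv b) p) =
    u k (cpoint (triv b) (rotate c p)) - u k (cpoint (triv b) p).
  by move=> [Ip _]; rewrite /psi rot_point.
have psiC b p : img' b p -> local_fun (u k) b (rotate c p) + -1 * local_fun (u k) b p =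
    local_fun psi b p.
  by move=> Ip; rewrite /local_fun psiE // rmorphB mulN1r.
have sr b := csmooth_rotate (su b) (fun q => @img'_rotate _ _ _ E b c q c0).
have sm b := csmoothZ (@open_img' _ _ _ E b) (-1) (su b).
have spsi : smooth' psi.
  move=> b; have oI := @open_img' _ _ _ E b.
  exact: (eq_csmooth oI (@psiC b) (csmoothD oI (sr b) (sm b))).
have hpsi : scaling k psi.
  move=> b z' w' s Uw' z0'; have es := expRC_neq0 s.
  rewrite !psiE; [|exact: img'_mkpt|by apply: img'_mkpt => //; rewrite mulf_neq0].
  rewrite /rotate !fiber_mkpt !base_mkpt mulrCA !hs ?mulf_neq0 //.
  by rewrite mulrBr.
have ddpsi b p : img' b p -> ddb (local_fun psi b) p = 0.
  move=> Ip; have oI := @open_img' _ _ _ E b.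
  rewrite -(eq_ddb oI Ip (@psiC b)) (ddbD oI (sr b) (sm b) Ip) (ddbZ _ oI (su b) Ip).
  suff -> : ddb (fun q => local_fun (u k) b (rotate c q)) p = ddb (local_fun (u k) b) p.
    by rewrite scaleN1r subrr.
  apply/matrixP => i i'; apply: etrans (ddb_rotate i i' oI (su b)
    (fun q => @img'_rotate _ _ _ E b c q c0) Ip) _.
  have /img'P[Uw' z0'] := Ip; rewrite -{2}(mkpt_fiber_base p) /rotate.
  have z1 : c * fiber p != 0 by rewrite mulf_neq0.
  have E1 := ddb_potential_scale k0 hu Uw' z1.
  have E2 := ddb_potential_scale k0 hu Uw' z0'.
  exact: (rot_entry i i' c0 z0' c1 E1 E2).
have Iz := img'_mkpt Uw z0.
have := pluriharmonic_zero hN hK j k0 spsi hpsi ddpsi Iz.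
rewrite psiE // /rotate fiber_mkpt base_mkpt => /eqP.
by rewrite subr_eq0 => /eqP.
Qed.

Lemma soliton_homogeneous k : (0 < d)%N -> (0 < k)%N -> homogeneous (k%:R / 2) (u k).
Proof.
move=> d0; elim/ltn_ind: k => k IH k0 a z w Uw z0.
have hu j : (0 < j < k)%N -> homogeneous (j%:R / 2) (u j) by move=> /andP[j0 jk]; exact: IH.
have n0 : 0 < normsq z by rewrite normsq_gt0.
(* Polar decomposition: s = log |z| is handled by [soliton_scaling], the unit number [c] by circle
   invariance. *)
pose s := ln (normsq z) / 2; pose c := (expR (- s))%:C * z.
have cE : z = (expR s)%:C * c.
  by rewrite /c mulrA -rmorphM -expRD subrr expR0 mul1r.
have c1 : normsq c = 1.
  rewrite /c normsqM normsq_real -expRM_natl mulrN /s mulrCA divff ?pnatr_eq0 // mulr1.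
  by rewrite expRN lnK ?posrE // mulVf // gt_eqF.
have c0 : c != 0 by rewrite -normsq_gt0 c1.
rewrite /local_fun [in LHS]cE (soliton_scaling k0) // -{1}[c]mulr1.
(* The first base coordinate, available since d > 0, serves as horizontal direction. *)
rewrite (circle_invariant (Ordinal d0) k0 c1 hu Uw (oner_neq0 _)) rmorphM.
by congr ((expR _)%:C * _); rewrite /s mulrA mulrAC.
Qed.

End CircleInvariance.

(** * The gradient potential *)

Section GradientPotential.
Context {R : realType} {d : nat} {D : compactComplexManifold R d} {E : lineBundle D}.
Variables (N : E -> R) (u : nat -> E -> R).
Hypothesis hN : hermitian_metric N.
Hypothesis hK : forall a : triv_index E, kahler_on (cimg (tchart a)) (curvature N a).
Hypothesis hS : formal_expanding_soliton N u.
Implicit Types (a : triv_index E) (z : R[i]) (w : Cn R d) (f : E -> R) (k : nat).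
Local Notation dom a := (cimg (tchart a)).

Lemma homogeneous_lie_fun l f a p : homogeneous l f -> img' a p ->
  lie_fun (@Vhol R d) (local_fun f a) p = (2 * l)%:C * local_fun f a p.
Proof.
move=> hf /img'P Wp.
exact: (homog_lie_fun (@open_dom _ _ _ E a) (hf a) Wp).
Qed.

Lemma local_funZ (l : R) f a :
  local_fun (fun e => l * f e) a = (fun q => l%:C * local_fun f a q).
Proof. by apply/funext => q; rewrite /local_fun rmorphM. Qed.

Lemma smooth'Z (l : R) f : smooth' f -> smooth' (fun e => l * f e).
Proof.
by move=> sf a; rewrite local_funZ; apply: csmoothZ; [exact: open_img'|exact: sf].
Qed.

Lemma homogeneousZ (l m : R) f : homogeneous l f -> homogeneous l (fun e => m * f e).
Proof. by move=> hf a z w Uw z0; rewrite local_funZ hf // mulrCA. Qed.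

(** The factor [l], half the weight of [f], is the eigenvalue of z d/dz on [f]. *)
Lemma homogeneous_gradient l f a p j : smooth' f -> homogeneous l f -> img' a p ->
  iprod (@Vhol R d) (ddb (local_fun f a)) p j =
  'i * dzb j (local_fun (fun e => l * f e) a) p.
Proof.
move=> sf hf Ip; have Wp := (img'P _ _).1 Ip.
rewrite (homog_iprod (@open_dom _ _ _ E a) (hf a) (csmooth_section (sf a)) j Wp).
rewrite local_funZ.
by rewrite (wirtinger_dzb (wirtingerZ l%:C (csmooth_wirtinger j (sf a) Ip))).
Qed.

Lemma metricV_homogeneous : homogeneous (-1) (fun e => (N e)^-1).
Proof.
move=> a z w Uw z0; rewrite !(metricV_homog hN) ?oner_neq0 //.
by rewrite rho_of1 mul1r.
Qed.

Lemma metricV_smooth' : smooth' (fun e => (N e)^-1).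
Proof.
move=> a; have oI := @open_img' _ _ _ E a; apply: csmooth_real => //.
have sN : smooth_on (img' a) (fun p => local_weight N a (base p) * normsq (fiber p)).
  apply: smooth_onM => //; last exact: smooth_normsq_fiber.
  apply: smooth_base; exact: smooth_weight.
apply: eq_smooth_on (smooth_onV oI _ sN) => //; apply: img'_ind => z w Uw z0.
- by rewrite (metricE hN) // base_mkpt fiber_mkpt.
- by rewrite base_mkpt fiber_mkpt mulf_neq0 // gt_eqF // ?normsq_gt0 // (weight_gt0 hN).
Qed.

(** Each nonzero component is half its weight times the function whose ddb is that component of
    omega, the shape given by [homogeneous_gradient]. In weight 0 the contraction vanishes, so the
    potential is 0 there. *)
Definition potential (k : int) : E -> R :=
  if k == - 2%:Z then (fun e => -1 * (N e)^-1)
  else if 0 < k then (fun e => (`|k|%N%:R / 2) * u `|k|%N e) else (fun=> 0).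

Lemma local_fun0 (a : triv_index E) : local_fun (fun _ : E => 0 : R) a = (fun=> 0).
Proof. by []. Qed.

(** The cases follow the branches in the definition of [omega]. *)
Variant degree_spec : int -> Type :=
  | DegreeMinusTwo : degree_spec (- 2%:Z)
  | DegreePos (k : nat) of (0 < k)%N : degree_spec k%:Z
  | DegreeZero : degree_spec 0
  | DegreeOther (k : int) of (k == - 2%:Z) = false & (k == 0) = false & (0 < k) = false :
      degree_spec k.

Lemma degreeP (k : int) : degree_spec k.
Proof.
case: k => [[|k]|[|[|k]]].
- exact: DegreeZero.
- exact: (@DegreePos k.+1).
- exact: DegreeOther.
- exact: DegreeMinusTwo.
- exact: DegreeOther.
Qed.

Lemma potential_pos k : (0 < k)%N -> potential k%:Z = (fun e => (k%:R / 2) * u k e).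
Proof. by case: k. Qed.

Lemma potential_formal : (0 < d)%N -> formal_function potential.
Proof.
have zero (k : int) : smooth' (fun _ : E => 0 : R) /\ weight k (fun _ : E => 0 : R).
  split=> a; first by rewrite local_fun0; exact: csmooth_cst.
  move=> p _; rewrite local_fun0 mulr0 /lie_fun big1 // => i _.
  rewrite (wirtinger_dz (wirtinger_cst i p 0)) (wirtinger_dzb (wirtinger_cst i p 0)).
  by rewrite !mulr0 addr0.
move=> d0; split.
  move=> k; case: (degreeP k) => [|n n0||n e1 e2 e3].
  - split; first exact/smooth'Z/metricV_smooth'.
    move=> a p Ip; rewrite (homogeneous_lie_fun (homogeneousZ (-1) metricV_homogeneous) Ip).
    by congr (_ * _); rewrite mulrN1 rmorphN rmorph_nat rmorphN.
  - rewrite potential_pos //; split.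
      by apply: smooth'Z; exact: (soliton_smooth hS).
    move=> a p Ip; rewrite (homogeneous_lie_fun (homogeneousZ _ (soliton_homogeneous hN hK hS d0 n0)) Ip).
    by rewrite mulrCA divff ?pnatr_eq0 // mulr1 rmorph_nat.
  - exact: zero.
  - by rewrite /potential e1 e3; exact: zero.
(* The series starts with the weight -2 term -1/|S|^2. *)
exists (- 2%:Z) => k kl a p Ip; rewrite /potential (lt_eqF kl) ltNge.
by rewrite (ltW (lt_trans kl _)).
Qed.

Lemma potential_gradient : (0 < d)%N -> gradient_potential N u potential.
Proof.
have dzb0 (p : Cn R (1 + d)) j a : dzb j (local_fun (fun _ : E => 0 : R) a) p = 0.
  exact: wirtinger_dzb (wirtinger_cst j p 0).
move=> d0 k a p Ip j; case: (degreeP k) => [|n n0||n e1 e2 e3].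
- exact: (homogeneous_gradient j metricV_smooth' metricV_homogeneous Ip).
- rewrite potential_pos // omega_pos //.
  apply: (homogeneous_gradient j (soliton_smooth hS n0) (soliton_homogeneous hN hK hS d0 n0) Ip).
- apply: etrans (iprod_ricci_omega0 hN hK j Ip) _.
  by rewrite dzb0 mulr0.
- rewrite /potential e1 e3 dzb0 mulr0 /iprod big1 ?mulr0 // => i _.
  by rewrite /omega e1 e2 e3 mxE mulr0.
Qed.

End GradientPotential.

Theorem proposition5p50 (R : realType) (d : nat)
    (D : compactComplexManifold R d) (E : lineBundle D) (N : E -> R)
    (u : nat -> E -> R) :
  (0 < d)%N ->
  ample E ->
  hermitian_metric N ->
  (forall a : triv_index E, kahler_on (cimg (tchart a)) (curvature N a)) ->
  formal_expanding_soliton N u ->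
  exists F : int -> E -> R, formal_function F /\ gradient_potential N u F.
Proof.
move=> d0 _ hN hK hS; exists (potential N u); split.
- exact: potential_formal.
- exact: potential_gradient.
Qed.
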